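(* Let $\mathcal{H}$ be a real Hilbert space, $N\ge 1$, and for $i=1,\dots,N$ let $A_i:\mathcal{H}\rightrightarrows\mathcal{H}$ be maximally monotone and $B_i:\mathcal{H}\to\mathcal{H}$ be monotone and $L_i$-Lipschitz continuous. Suppose $\big(\sum_{i=1}^N (A_i+B_i)\big)^{-1}(0)\neq\varnothing$. Let $W$ be a mixing matrix for a connected graph on $\{1,\dots,N\}$, let $\alpha_1,\dots,\alpha_N$ satisfy $0<\alpha_i<1/(8L_i)$, set $\Lambda=\mathrm{diag}(\alpha_1,\dots,\alpha_N)$, choose $\beta$ with $0<\beta<\|\Lambda^{1/2}((I-W)/2)\Lambda^{1/2}\|^{-1}$, and set $\widetilde W = I-(\beta/2)\Lambda(I-W)$. Choose $\mathbf{y}^0,\mathbf{z}^0\in\mathcal{H}^N$, set $\mathbf{v}^0=B(\mathbf{y}^0)$, and define $\mathbf{x}^0=J_{\Lambda A}(\mathbf{z}^0)$, $\mathbf{y}^1=2\mathbf{x}^0-\mathbf{z}^0-\Lambda\mathbf{v}^0$, $\mathbf{z}^1=\mathbf{y}^1+\mathbf{z}^0-\mathbf{x}^0$, $\mathbf{x}^1=J_{\Lambda A}(\mathbf{z}^1)$, and for all $k\ge 1$: $\mathbf{v}^k=2B(\mathbf{y}^k)-B(\mathbf{y}^{k-1})$, $\mathbf{z}^{k+1}=\mathbf{z}^k-\mathbf{x}^k+\widetilde W\big(2\mathbf{x}^k-\mathbf{x}^{k-1}-\Lambda(\mathbf{v}^k-\mathbf{v}^{k-1})\big)$, $\mathbf{x}^{k+1}=J_{\Lambda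 A}(\mathbf{z}^{k+1})$, $\mathbf{y}^{k+1}=\mathbf{x}^k+\mathbf{z}^{k+1}-\mathbf{z}^k$. Then: (i) $\mathbf{z}^k\rightharpoonup\mathbf{z}^*$ for some $\mathbf{z}^*\in\mathcal{H}^N$; (ii) $\mathbf{x}^k\rightharpoonup\mathbf{x}^*$ and $\mathbf{y}^k\rightharpoonup\mathbf{x}^*$, where $\mathbf{x}^*=J_{\Lambda A}(\mathbf{z}^* )$; (iii) $\mathbf{x}^*=(x^*,\dots,x^* )\in\mathcal{H}^N$ with $x^*\in\big(\sum_{i=1}^N (A_i+B_i)\big)^{-1}(0)$.
   Context: $\rightharpoonup$ denotes weak convergence. $\mathcal{H}^N$ is the product Hilbert space with elements $\mathbf{x}=(x_1,\dots,x_N)$. Operators on $\mathcal{H}^N$: $A(\mathbf{x})=A_1(x_1)\times\dots\times A_N(x_N)$, $B(\mathbf{x})=(B_1(x_1),\dots,B_N(x_N))$. A real $N\times N$ matrix $M$ acts on $\mathcal{H}^N$ as $M\otimes I$ (Kronecker product with the identity of $\mathcal{H}$), and norms/definiteness of $M$ refer to this (equivalently to $M$ itself). $J_{T}=(I+T)^{-1}$ is the resolvent, so $J_{\Lambda A}=(I+\Lambda A)^{-1}$. Given a connected graph $(\mathcal{V},\mathcal{E})$ with $\mathcal{V}=\{1,\dots,N\}$, a matrix $W=(w_{ij})\in\mathbb{R}^{N\times N}$ is a mixing matrix if: $w_{ij}=0$ whenever $i\ne j$ and $(i,j)\notin\mathcal{E}$; $W=W^\top$; $\ker(I-W)=\mathbb{R}\mathbf{1}$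 where $\mathbf{1}=(1,\dots,1)^\top$; and $-I\prec W\preceq I$ in the Loewner order. *)

(* Defs.v *)
From HB Require Import structures.
From mathcomp Require Import all_boot all_order all_algebra.
From mathcomp Require Import all_classical all_reals all_analysis.
Set Implicit Arguments. Unset Strict Implicit. Unset Printing Implicit Defensive.
Import Order.TTheory GRing.Theory Num.Theory.
Import numFieldNormedType.Exports.
Local Open Scope classical_set_scope.
Local Open Scope ring_scope.

Section Defs.
Variable R : realType.

(** A real Hilbert space: a complete normed space [H] whose norm is induced
    by the inner product [ip]. *)
Definition is_inner_product (H : normedModType R) (ip : H -> H -> R) : Prop :=
  [/\ forall x y, ip x y = ip y x,
      forall (a : R) x y z, ip (a *: x + y) z = a * ip x z + ip y z
    & forall x, ip x x = `|x| ^+ 2].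

Variable H : completeNormedModType R.
Variable ip : H -> H -> R.

Definition monotone_op (A : H -> set H) : Prop :=
  forall x y u v, A x u -> A y v -> 0 <= ip (x - y) (u - v).

Definition maximally_monotone (A : H -> set H) : Prop :=
  monotone_op A /\
  forall A' : H -> set H, monotone_op A' ->
    (forall x u, A x u -> A' x u) -> forall x u, A' x u -> A x u.

Definition monotone_fun (B : H -> H) : Prop :=
  forall x y, 0 <= ip (x - y) (B x - B y).

Definition lipschitz_with (L : R) (B : H -> H) : Prop :=
  forall x y, `|B x - B y| <= L * `|x - y|.

(** Resolvent J_{aA} = (I + aA)^{-1}, evaluated at z (single-valued for
    maximally monotone A and a > 0, by Minty's theorem). *)
Definition resolvent (a : R) (A : H -> set H) (z : H) : H :=
  xget 0 [set x | exists u, A x u /\ z = x + a *: u].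

Definition weak_cvg (u : nat -> H) (l : H) : Prop :=
  forall w, (fun k => ip (u k) w) @ \oo --> ip l w.

Variable N : nat.

Definition prod_ip (x w : 'I_N -> H) : R := \sum_i ip (x i) (w i).

Definition weak_cvgN (u : nat -> 'I_N -> H) (l : 'I_N -> H) : Prop :=
  forall w, (fun k => prod_ip (u k) w) @ \oo --> prod_ip l w.

Definition mxact (M : 'M[R]_N) (x : 'I_N -> H) : 'I_N -> H :=
  fun i => \sum_j M i j *: x j.

Definition resolventN (alpha : 'I_N -> R) (A : 'I_N -> H -> set H)
  (z : 'I_N -> H) : 'I_N -> H :=
  fun i => resolvent (alpha i) (A i) (z i).

Definition opB (B : 'I_N -> H -> H) (x : 'I_N -> H) : 'I_N -> H :=
  fun i => B i (x i).

Definition is_zero_of_sum (A : 'I_N -> H -> set H) (B : 'I_N -> H -> H)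
  (x : H) : Prop :=
  exists u : 'I_N -> H, (forall i, A i x (u i)) /\ \sum_i (u i + B i x) = 0.

End Defs.

Section Matrices.
Variable R : realType.
Variable N : nat.

Definition vnorm (v : 'cV[R]_N) : R := Num.sqrt (\sum_i v i 0 ^+ 2).

Definition mx_opnorm (M : 'M[R]_N) : R :=
  sup [set vnorm (M *m v) | v in [set v : 'cV[R]_N | vnorm v <= 1]].

Definition mx_psd (M : 'M[R]_N) : Prop :=
  forall v : 'cV[R]_N, 0 <= (v^T *m M *m v) 0 0.

Definition mx_pd (M : 'M[R]_N) : Prop :=
  forall v : 'cV[R]_N, v != 0 -> 0 < (v^T *m M *m v) 0 0.

Definition connected_graph (E : rel 'I_N) : Prop :=
  (forall i j, E i j = E j i) /\ (forall i j, connect E i j).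

Definition mixing_matrix (E : rel 'I_N) (W : 'M[R]_N) : Prop :=
  [/\ forall i j, i != j -> ~~ E i j -> W i j = 0,
      W^T = W,
      (forall v : 'cV[R]_N, (1%:M - W) *m v = 0 <-> exists c : R, v = c *: const_mx 1),
      mx_pd (W + 1%:M)
    & mx_psd (1%:M - W)].

End Matrices.

(* Main.v *)
(** Put [D = (beta/2)(I-W)] and [w^k = Lam^{-1}(x^k - z^{k+1}) - v^k].  The scheme
    becomes [z^{k+1} = x^k - Lam(v^k + w^k)] and
    [w^k - w^{k-1} = D(y^{k+1} + Lam(w^k - w^{k-1}))], where every [w^k] has zero sum,
    i.e. lies in the range of [D].  With [Y] an inverse of [D] on that range, the step
    size condition makes [Q = Y - Lam] positive semidefinite there.  Monotonicity of the
    [A_i] and [B_i] then shows that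
    [|z^{k+1}-zs|^2_{1/Lam} + |w^k-ws|^2_Q], corrected by terms in consecutive
    differences which [alpha_i L_i < 1/8] controls, is nonincreasing for every saddle
    point [(zs, ws)].  Hence the differences vanish, weak cluster points are saddle
    points, and Opial's argument identifies all of them.  Weak limits are taken along
    ultrafilters on [nat], where the Riesz representation theorem produces them
    directly; resolvents are everywhere defined by Minty's theorem. *)

Require Import Defs.
From HB Require Import structures.
From mathcomp Require Import all_boot all_order all_algebra.
From mathcomp Require Import all_classical all_reals all_analysis.
From mathcomp Require Import ring lra.
Set Implicit Arguments.
Unset Strict Implicit.
Unset Printing Implicit Defensive.
Import Order.TTheory GRing.Theory Num.Theory.
Import numFieldNormedType.Exports.
Local Open Scope classical_set_scope.
Local Open Scope ring_scope.

(** * Strongly convex minimization, Riesz and Minty *)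

(** Passing to the limit in the monotonicity inequalities is delicate: in
    [<x^k, Lam^{-1}(z^k - x^k)>] and [<y^{k+1}, B(y^{k+1})>] both factors converge only weakly.
    Summed over all components, the bilinear part of these products reduces, up to vanishing errors,
    to [-<w^k, y^{k+1}>]. The dual equation rewrites this as [-<w^k, Q(w^k - w^{k-1})>], which tends
    to zero by Cauchy-Schwarz. The limit inequality is therefore available only in summed form, and
    the inclusions for the single [A_i] and [B_i] are extracted from it by well-chosen test points.
    A second difficulty is that [Q] is only known to be semidefinite: the Lyapunov function does not
    bound [w^k] in norm, so boundedness is read off from the formula for [w^k], and Opial's argument
    identifies only the [z] component. The [x] component then follows through the resolvent. *)

Lemma cvg_ge0 (R : realType) (T : Type) (F : set_system T) (FF : ProperFilter F)
    (f : T -> R) (l : R) :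
  (forall t, 0 <= f t) -> f @ F --> l -> 0 <= l.
Proof.
move=> f0 fl; rewrite -(cvg_lim _ fl)//; apply: limr_ge; last exact: nearW.
by apply/cvg_ex; exists l.
Qed.

Section InnerProduct.
Variables (R : realType) (H : completeNormedModType R) (ip : H -> H -> R).
Hypothesis hip : is_inner_product ip.

Lemma ipC (x y : H) : ip x y = ip y x.
Proof. by case: hip. Qed.

Lemma ipDl (x y z : H) : ip (x + y) z = ip x z + ip y z.
Proof. by case: hip => _ h _; have := h 1 x y z; rewrite scale1r mul1r. Qed.

Lemma ip0l (z : H) : ip 0 z = 0.
Proof. by have := ipDl 0 0 z; rewrite addr0; lra. Qed.

Lemma ipZl (a : R) (x z : H) : ip (a *: x) z = a * ip x z.
Proof. by case: hip => _ h _; have := h a x 0 z; rewrite addr0 ip0l addr0. Qed.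

Lemma ipNl (x z : H) : ip (- x) z = - ip x z.
Proof. by rewrite -scaleN1r ipZl mulN1r. Qed.

Lemma ipDr (x y z : H) : ip z (x + y) = ip z x + ip z y.
Proof. by rewrite ![ip z _]ipC ipDl. Qed.

Lemma ipZr (a : R) (x z : H) : ip z (a *: x) = a * ip z x.
Proof. by rewrite ![ip z _]ipC ipZl. Qed.

Lemma ipNr (x z : H) : ip z (- x) = - ip z x.
Proof. by rewrite ![ip z _]ipC ipNl. Qed.

Lemma ip0r (z : H) : ip z 0 = 0.
Proof. by rewrite ipC ip0l. Qed.

Definition ipE := (ipDl, ipDr, ipNl, ipNr, ipZl, ipZr).

Lemma ipxx (x : H) : ip x x = `|x| ^+ 2.
Proof. by case: hip. Qed.

Lemma ipxx_ge0 (x : H) : 0 <= ip x x.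
Proof. by rewrite ipxx sqr_ge0. Qed.

Lemma ipxx_eq0 (x : H) : ip x x = 0 -> x = 0.
Proof. by rewrite ipxx => /eqP; rewrite sqrf_eq0 normr_eq0 => /eqP. Qed.

(* Reduces identities between vectors to identities between scalars, for [ring]. *)
Lemma ip_ext (x y : H) : (forall h, ip x h = ip y h) -> x = y.
Proof.
move=> e; apply/eqP; rewrite -subr_eq0; apply/eqP/ipxx_eq0.
by rewrite ipDl ipNl e subrr.
Qed.

Lemma ip_young (x y : H) (t : R) : 0 < t -> 2 * ip x y <= t * ip x x + t^-1 * ip y y.
Proof.
move=> t0; have := ipxx_ge0 (t *: x - y); rewrite !ipE (ipC y x) => h.
have -> : t * ip x x + t^-1 * ip y y
   = 2 * ip x y + t^-1 * (t * (t * ip x x - ip x y) - (t * ip x y - ip y y)).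
  by field; rewrite gt_eqF.
by rewrite lerDl mulr_ge0// invr_ge0 ltW.
Qed.

Lemma normr_ip (x y : H) : `|ip x y| <= `|x| * `|y|.
Proof.
have [->|x0] := eqVneq x 0; first by rewrite ip0l !normr0 mul0r.
have [->|y0] := eqVneq y 0; first by rewrite ip0r !normr0 mulr0.
have nx : 0 < `|x| by rewrite normr_gt0.
have ny : 0 < `|y| by rewrite normr_gt0.
have t0 : 0 < `|y| / `|x| by rewrite divr_gt0.
have e : `|y| / `|x| * `|x| ^+ 2 + (`|y| / `|x|)^-1 * `|y| ^+ 2 = 2 * (`|x| * `|y|).
  by field; rewrite !gt_eqF.
have := ip_young x y t0; have := ip_young (- x) y t0.
rewrite !ipE !opprK !ipxx e => h1 h2.
rewrite ler_norml; apply/andP; split; lra.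
Qed.

Lemma ip_cvgl (T : Type) (F : set_system T) (FF : Filter F) (u : T -> H) (l h : H) :
  u @ F --> l -> (fun t => ip (u t) h) @ F --> ip l h.
Proof.
move=> ul; have : (fun t => `|u t - l| * `|h|) @ F --> (0 : R).
  rewrite -[X in _ --> X](mul0r `|h|); apply: cvgMr_tmp.
  by apply/norm_cvg0P; rewrite -(subrr l); apply: cvgB => //; exact: cvg_cst.
move=> h0; apply: (@squeeze_cvgr _ _ _ _ (fun t => ip l h - `|u t - l| * `|h|) 
  (fun t => ip l h + `|u t - l| * `|h|)).
- apply: nearW => t; have := normr_ip (u t - l) h.
  by rewrite !ipE ler_norml => /andP[? ?]; apply/andP; split; lra.
- by rewrite -[X in _ --> X]subr0; apply: cvgB => //; exact: cvg_cst.
- by rewrite -[X in _ --> X]addr0; apply: cvgD => //; exact: cvg_cst.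
Qed.

End InnerProduct.

Section StrongConvexity.
Variables (R : realType) (H : completeNormedModType R) (ip : H -> H -> R).
Hypothesis hip : is_inner_product ip.
Let ipE := ipE hip.

Lemma ge0_of_quadratic (g q : R) :
  0 <= q -> (forall l : R, 0 <= l -> l <= 1 -> 0 <= l * g + l ^+ 2 * q) -> 0 <= g.
Proof.
move=> q0 h; rewrite leNgt; apply/negP => g0.
(* If [g < 0], the step [- g / (2 * (q - g))] lies in [0, 1] and makes the quadratic negative;
   subtracting [g] in the denominator keeps it positive even for [q = 0]. *)
have d0 : 0 < 2 * (q - g) by lra.
have l0 : 0 <= - g / (2 * (q - g)) by apply: divr_ge0; lra.
have l1 : - g / (2 * (q - g)) <= 1 by rewrite ler_pdivrMr//; lra.
have := h _ l0 l1.
have -> : - g / (2 * (q - g)) * g + (- g / (2 * (q - g))) ^+ 2 * q =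
          (g / (2 * (q - g))) ^+ 2 * (2 * g - q) by field; lra.
rewrite pmulr_rge0; first lra.
by rewrite exprn_even_gt0//= mulf_neq0// ?invr_neq0// ?(lt_eqF g0)// (gt_eqF d0).
Qed.

(** [C] is a nonempty closed convex subset of [H * H * R], to be thought of as an epigraph. The
    conclusion is the first-order condition at the minimizer of [t + |x|^2/2 + |u|^2/2]. Both Riesz
    (with [u = 0]) and Minty are instances. *)
Lemma half_normsq_minimizer (C : H -> H -> R -> Prop) :
  (exists x u t, C x u t) ->
  (forall (l : R) x u (t : R) x' u' (t' : R), 0 <= l -> l <= 1 -> C x u t -> C x' u' t' ->
     C (x + l *: (x' - x)) (u + l *: (u' - u)) (t + l * (t' - t))) ->
  (forall (x u : nat -> H) (t : nat -> R) x0 u0 (t0 : R), (forall n, C (x n) (u n) (t n)) ->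
     x @ \oo --> x0 -> u @ \oo --> u0 -> t @ \oo --> t0 -> C x0 u0 t0) ->
  (exists m : R, forall x u t, C x u t -> m <= t + ip x x / 2 + ip u u / 2) ->
  exists x0 u0 t0, C x0 u0 t0 /\
    forall x u t, C x u t -> t0 <= t + ip x0 (x - x0) + ip u0 (u - u0).
Proof.
move=> [x1 [u1 [t1 C1]]] cvx cld [b hb].
pose val x u t := t + ip x x / 2 + ip u u / 2 : R.
pose S := [set r | exists x u t, C x u t /\ r = val x u t].
have Sinf : has_inf S.
  split; first by exists (val x1 u1 t1), x1, u1, t1.
  by exists b => r [x [u [t [Ct ->]]]]; exact: hb.
pose m := inf S.
have hm x u t : C x u t -> m <= val x u t.
  by move=> Ct; apply: ge_inf; [case: Sinf | exists x, u, t].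
pose d (n : nat) : R := n.+1%:R^-1.
have d0 n : 0 < d n by rewrite invr_gt0 ltr0Sn.
have ex n : exists p : H * H * R, C p.1.1 p.1.2 p.2 /\ val p.1.1 p.1.2 p.2 < m + d n.
  have [r [x [u [t [Ct ->]]]] lt] := inf_adherent (d0 n) Sinf.
  by exists (x, u, t).
have [p hp] := choice ex.
pose x n := (p n).1.1; pose u n := (p n).1.2; pose t n := (p n).2.
have Cn n : C (x n) (u n) (t n) by have [] := hp n.
have vn n : val (x n) (u n) (t n) < m + d n by have [] := hp n.
(* The midpoint of two almost optimal points has value at least [m], so the parallelogram identity
   bounds their distance: minimizing sequences are Cauchy. *)
have close i j : `|x i - x j| ^+ 2 + `|u i - u j| ^+ 2 <= 4 * (d i + d j).
  have h0 : 0 <= 2^-1 :> R by lra.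
  have h1 : 2^-1 <= 1 :> R by lra.
  have := hm _ _ _ (cvx 2^-1 _ _ _ _ _ _ h0 h1 (Cn i) (Cn j)).
  move: (vn i) (vn j); rewrite /val -!(ipxx hip) !ipE.
  rewrite (ipC hip (x j) (x i)) (ipC hip (u j) (u i)); lra.
have cau (f : nat -> H) : (forall i j, `|f i - f j| ^+ 2 <= 4 * (d i + d j)) -> cvgn f.
  move=> hf; apply: cauchy_cvg; apply: cauchy_exP => e e0.
  have d_cvg : d @ \oo --> (0:R) by exact: cvg_harmonic.
  have e8 : 0 < e ^+ 2 / 8 by rewrite divr_gt0 ?exprn_gt0.
  have [K _ hK] := cvgr0_norm_lt _ d_cvg _ e8.
  exists (f K); exists K => // n /= Kn.
  rewrite -ball_normE /= -ltr_sqr ?nnegrE// ?ltW//.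
  have := hK _ Kn; have := hK _ (leqnn K).
  by rewrite /= !gtr0_norm// => h1 h2; apply: le_lt_trans (hf K n) _; lra.
have /cvg_ex[x0 xc] : cvgn x.
  by apply: cau => i j; apply: le_trans (close i j); rewrite lerDl sqr_ge0.
have /cvg_ex[u0 uc] : cvgn u.
  by apply: cau => i j; apply: le_trans (close i j); rewrite lerDr sqr_ge0.
have sq (f : nat -> H) f0 : f @ \oo --> f0 ->
    (fun n => ip (f n) (f n) / 2) @ \oo --> ip f0 f0 / 2.
  move=> fc; apply: cvgMr_tmp; rewrite (ipxx hip).
  under eq_cvg do rewrite (ipxx hip).
  by rewrite expr2; apply: cvgM; exact: cvg_norm.
(* Nothing controls [t n] directly; its limit is what the limits of the value and of the two norms
   leave over. *)
pose t0 := m - ip x0 x0 / 2 - ip u0 u0 / 2.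
have valc : (fun n => val (x n) (u n) (t n)) @ \oo --> m.
  apply: (@squeeze_cvgr _ _ _ _ (fun=> m) (fun n => m + d n)).
  - by apply: nearW => n; rewrite hm//= ltW.
  - exact: cvg_cst.
  - rewrite -[X in _ --> X]addr0; apply: cvgD; [exact: cvg_cst|exact: cvg_harmonic].
have tc : t @ \oo --> t0.
  have -> : t = (fun n => val (x n) (u n) (t n) - ip (x n) (x n) / 2 - ip (u n) (u n) / 2).
    by apply/funext => n; rewrite /val; ring.
  by apply: cvgB; [apply: cvgB => //|]; exact: sq.
have C0 := cld _ _ _ _ _ _ Cn xc uc tc.
exists x0, u0, t0; split => // x' u' t' C'.
rewrite -subr_ge0.
apply: (@ge0_of_quadratic _ (ip (x' - x0) (x' - x0) / 2 + ip (u' - u0) (u' - u0) / 2)).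
  by have := ipxx_ge0 hip (x' - x0); have := ipxx_ge0 hip (u' - u0); lra.
move=> l l0 l1; have := hm _ _ _ (cvx _ _ _ _ _ _ _ l0 l1 C0 C').
rewrite /val /t0 -subr_ge0; move: (x' - x0) (u' - u0) => dx du.
rewrite !ipE (ipC hip dx x0) (ipC hip du u0) => h; apply: le_trans h _.
by rewrite le_eqVlt; apply/orP; left; apply/eqP; field.
Qed.

(** The representing vector minimizes [|x|^2/2 - f x]. The first-order condition gives
    [f h <= ip x0 h] for every [h], and replacing [h] by [- h] gives equality. *)
Lemma riesz (f : H -> R) :
  (forall x y, f (x + y) = f x + f y) -> (forall a x, f (a *: x) = a * f x) ->
  (exists c, forall x, `|f x| <= c * `|x|) -> exists g, forall x, f x = ip g x.
Proof.
move=> fD fZ [c hc].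
have fN x : f (- x) = - f x by rewrite -scaleN1r fZ mulN1r.
have f0 : f 0 = 0 by rewrite -(scale0r 0) fZ mul0r.
have [||||x0 [u0 [t0 [[u00 h0] hmin]]]] :=
    @half_normsq_minimizer (fun x u t => u = 0 /\ - f x <= t).
- by exists 0, 0, 0; rewrite f0 oppr0.
- move=> l x u t x' u' t' l0 l1 [-> h] [-> h']; split; first by rewrite subrr scaler0 addr0.
  rewrite fD fZ fD fN; nra.
- move=> x u t x0 u0 t0 h xc uc tc; split.
    have uE : u = fun=> 0 by apply/funext => n; have [] := h n.
    by rewrite uE in uc; exact: (cvg_unique _ uc (cvg_cst _)).
  have fxc : (fun n => f (x n)) @ \oo --> f x0.
    have h0 : (fun n => c * `|x n - x0|) @ \oo --> (0 : R).
      rewrite -[X in _ --> X](mulr0 c); apply: cvgMl_tmp.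
      by apply/norm_cvg0P; rewrite -(subrr x0); apply: cvgB => //; exact: cvg_cst.
    apply: (@squeeze_cvgr _ _ _ _ (fun n => f x0 - c * `|x n - x0|)
      (fun n => f x0 + c * `|x n - x0|)).
    + apply: nearW => n; have := hc (x n - x0).
      by rewrite fD fN ler_norml => /andP[? ?]; apply/andP; split; lra.
    + by rewrite -[X in _ --> X]subr0; apply: cvgB => //; exact: cvg_cst.
    + by rewrite -[X in _ --> X]addr0; apply: cvgD => //; exact: cvg_cst.
  rewrite -subr_ge0 opprK.
  apply: (@cvg_ge0 _ _ \oo _ (fun n => t n + f (x n))); last first.
    exact: (cvgD tc fxc).
  by move=> n; have [_] := h n; lra.
- exists (- (c ^+ 2 / 2)) => x u t [-> h]; rewrite (ip0l hip) mul0r addr0.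
  have := hc x; rewrite ler_norml => /andP[_ h1].
  have := sqr_ge0 (`|x| - c); rewrite (ipxx hip); nra.
exists x0.
have le h : f h <= ip x0 h.
  have := hmin (x0 + h) 0 (- f (x0 + h)) (conj erefl (lexx _)).
  have -> : x0 + h - x0 = h by rewrite addrAC subrr add0r.
  by rewrite fD u00 (ip0l hip); lra.
move=> x; apply/eqP; rewrite eq_le le /=.
by have := le (- x); rewrite fN !ipE; lra.
Qed.

End StrongConvexity.

Section Resolvent.
Variables (R : realType) (H : completeNormedModType R) (ip : H -> H -> R).
Hypothesis hip : is_inner_product ip.
Let ipE := ipE hip.

(** Adjoining the single pair [(x, u)] to the graph keeps it monotone. This pointwise form of
    maximality survives the shift and rescaling in [minty]. *)
Lemma maximally_monotone_mem (A : H -> set H) (x u : H) :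
  maximally_monotone ip A -> (forall y v, A y v -> 0 <= ip (x - y) (u - v)) -> A x u.
Proof.
move=> [mA maxA] h.
apply: (maxA (fun y v => A y v \/ (y = x /\ v = u))); [|by left|by right].
move=> y y' v v' [Av|[-> ->]] [Av'|[-> ->]]; last by rewrite subrr (ip0l hip).
- exact: mA.
- by have := h _ _ Av; rewrite !ipE; lra.
- exact: h.
Qed.

(* The Simons-Zalinescu argument: minimise the Fitzpatrick function of [T] plus
   half the squared norm. [C] below is the epigraph of the Fitzpatrick function. *)
Lemma minty0 (T : H -> set H) :
  monotone_op ip T ->
  (forall x u, (forall y v, T y v -> 0 <= ip (x - y) (u - v)) -> T x u) ->
  exists x, T x (- x).
Proof.
move=> mT maxT.
pose C x u (t : R) := forall y v, T y v -> ip x v + ip y u - ip y v <= t.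
(* The Fitzpatrick function dominates the pairing: a pair outside [T] has, by maximality, a graph
   point with negative product against it. *)
have C_ge x u t : C x u t -> ip x u <= t.
  move=> Ct; have [Txu|nT] := pselect (T x u); first by have := Ct _ _ Txu; lra.
  have [y [v [Tyv lt]]] : exists y v, T y v /\ ip (x - y) (u - v) < 0.
    apply: contrapT => hn; apply: nT; apply: maxT => y v Tyv.
    by rewrite leNgt; apply/negP => lt; apply: hn; exists y, v.
  by have := Ct _ _ Tyv; move: lt; rewrite !ipE; lra.
have [y1 [v1 T1]] : exists y v, T y v.
  apply: contrapT => hn; apply: (hn); exists 0, 0; apply: maxT => y v Tyv.
  by exfalso; apply: hn; exists y, v.
have [||||x0 [u0 [t0 [C0 hmin]]]] := @half_normsq_minimizer _ _ _ hip C.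
- exists y1, v1, (ip y1 v1) => y v Tyv.
  by have := mT _ _ _ _ T1 Tyv; rewrite !ipE; lra.
- move=> l x u t x' u' t' l0 l1 h h' y v Tyv.
  have := h _ _ Tyv; have := h' _ _ Tyv; rewrite !ipE; nra.
- move=> x u t x0 u0 t0 h xc uc tc y v Tyv.
  rewrite -subr_ge0.
  apply: (@cvg_ge0 _ _ \oo _ (fun n => t n - (ip (x n) v + ip (u n) y - ip y v))).
  + by move=> n; have := h n _ _ Tyv; rewrite (ipC hip y (u n)); lra.
  + rewrite (ipC hip y u0); apply: cvgB => //; apply: cvgB; last exact: cvg_cst.
    by apply: cvgD; exact: ip_cvgl.
- exists 0 => x u t /C_ge h.
  by have := ipxx_ge0 hip (x + u); rewrite !ipE (ipC hip u x); lra.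
(* A graph point [(y, v)] lies in the epigraph at height [ip y v], so it can be tested in the
   first-order condition. The result says that [(- u0, - x0)] is monotonically related to all of
   [T]; used once more at that very point it forces [x0 + u0 = 0]. *)
have key y v : T y v -> ip (x0 + u0) (x0 + u0) <= ip (y + u0) (v + x0).
  move=> Tyv; have h1 : C y v (ip y v).
    by move=> y' v' T'; have := mT _ _ _ _ Tyv T'; rewrite !ipE; lra.
  have := hmin _ _ _ h1; have := C_ge _ _ _ C0.
  by rewrite !ipE (ipC hip x0 y) (ipC hip u0 x0); lra.
have T0 : T (- u0) (- x0).
  apply: maxT => y v Tyv; have := key _ _ Tyv; have := ipxx_ge0 hip (x0 + u0).
  have -> : ip (- u0 - y) (- x0 - v) = ip (y + u0) (v + x0) by rewrite !ipE; ring.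
  by move=> h1 h2; exact: le_trans h1 h2.
exists (- u0); suff -> : - - u0 = - x0 by [].
have := key _ _ T0; rewrite addNr (ip0l hip) => le0.
have /(ipxx_eq0 hip)/eqP : ip (x0 + u0) (x0 + u0) = 0.
  by apply/eqP; rewrite eq_le le0 ipxx_ge0.
by rewrite addr_eq0 => /eqP ->; rewrite opprK.
Qed.

(** Apply [minty0] to [a A - z]: a point whose image contains its own negative solves
    [z = x + a u]. *)
Lemma minty (A : H -> set H) (a : R) (z : H) :
  maximally_monotone ip A -> 0 < a -> exists x u, A x u /\ z = x + a *: u.
Proof.
move=> mA a0; have a_neq0 : a != 0 by rewrite gt_eqF.
have [||x Tx] := @minty0 (fun y v => A y (a^-1 *: (v + z))).
- move=> x y u v Ax Ay; have := mA.1 _ _ _ _ Ax Ay.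
  rewrite -scalerBr opprD addrACA subrr addr0 (ipZr hip) pmulr_rge0//.
  by rewrite invr_gt0.
- move=> x u h; apply: (maximally_monotone_mem mA) => y v Ayv.
  have := h y (a *: v - z); rewrite subrK scalerA mulVf// scale1r => /(_ Ayv).
  have -> : u - (a *: v - z) = a *: (a^-1 *: (u + z) - v).
    by rewrite scalerBr scalerA mulfV// scale1r opprB addrA addrAC.
  by rewrite (ipZr hip) pmulr_rge0.
exists x, (a^-1 *: (- x + z)); split => //.
by rewrite scalerA mulfV// scale1r addrA subrr add0r.
Qed.

(** By [minty] the defining set is nonempty, so the default value 0 of [xget] is never returned. *)
Lemma resolventP (A : H -> set H) (a : R) (z : H) :
  maximally_monotone ip A -> 0 < a ->
  A (resolvent a A z) (a^-1 *: (z - resolvent a A z)).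
Proof.
move=> mA a0.
have /(xgetPex 0)[u [Au zE]] : exists x, [set x | exists u, A x u /\ z = x + a *: u] x.
  exact: minty.
rewrite -/(resolvent a A z) in Au zE *.
by rewrite [X in X - _]zE addrAC subrr add0r scalerA mulVf ?gt_eqF// scale1r.
Qed.

Lemma resolvent_eq (A : H -> set H) (a : R) (x u : H) :
  maximally_monotone ip A -> 0 < a -> A x u -> resolvent a A (x + a *: u) = x.
Proof.
move=> mA a0 Au; have /= := resolventP (x + a *: u) mA a0.
set p := resolvent _ _ _ => Ap; have := mA.1 _ _ _ _ Ap Au.
have -> : a^-1 *: (x + a *: u - p) - u = - a^-1 *: (p - x).
  rewrite -[u in X in X = _]opprK.
  by rewrite addrAC scalerDr scalerA mulVf ?gt_eqF// scale1r addrK scaleNr -scalerN opprB.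
rewrite (ipZr hip) mulNr oppr_ge0 pmulr_rle0 ?invr_gt0// => le0.
apply/eqP; rewrite -subr_eq0; apply/eqP/(ipxx_eq0 hip)/eqP.
by rewrite eq_le le0 (ipxx_ge0 hip).
Qed.

End Resolvent.

(** * Weak limits along ultrafilters *)

Section Ultrafilters.

Lemma fmap_ultra (T T' : Type) (f : T -> T') (U : set_system T) :
  UltraFilter U -> UltraFilter (f @ U).
Proof.
move=> UU; split; first exact: fmap_proper_filter.
move=> G GF sUG; rewrite predeqE => A; split; last exact: sUG.
move=> GA; have [//|UnA] := in_ultra_setVsetC (f @^-1` A) UU.
exfalso; apply: (@filter_not_empty _ G GF); rewrite -(setICr A).
by apply: filterI => //; exact: sUG.
Qed.

(** If a neighborhood's preimage were not in [F], the trace of [F] on its complement would be proper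
    and would extend to an ultrafilter along which [f] does not converge. *)
Lemma cvg_ultraP (T : Type) (V : topologicalType) (F : set_system T) (f : T -> V) (l : V) :
  ProperFilter F -> (forall U, UltraFilter U -> F `<=` U -> f @ U --> l) -> f @ F --> l.
Proof.
move=> FF h A nA; apply: contrapT => nFA.
have GF : ProperFilter (within (~` (f @^-1` A)) F).
  split; last exact: within_filter.
  move=> F0; apply: nFA; apply: (@filterS _ F _ _ _ _ F0) => t /= nA0.
  by apply: contrapT => /nA0.
have [U [UU sGU]] := ultraFilterLemma GF.
have sFU : F `<=` U by move=> B FB; apply: sGU; apply: (@filterS _ F _ _ _ _ FB) => t Bt _.
have UA : U (f @^-1` A) by exact: (h U UU sFU A nA).
have UnA : U (~` (f @^-1` A)) by apply: sGU; by apply: withinT.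
apply: (@filter_not_empty _ U _); rewrite -(setICr (f @^-1` A)).
exact: filterI.
Qed.

Lemma bounded_ultra_cvg (R : realType) (T : Type) (U : set_system T) (f : T -> R) (M : R) :
  UltraFilter U -> (forall t, `|f t| <= M) -> exists l : R, f @ U --> l.
Proof.
move=> UU fM; have := @segment_compact R (- M) M; rewrite compact_ultra.
move=> /(_ (f @ U) (fmap_ultra f UU)) []; last by move=> l [_ hl]; exists l.
by apply: nearW => t /=; rewrite in_itv /= -ler_norml.
Qed.

End Ultrafilters.

Lemma cvg_real_unique (R : realType) (T : Type) (F : set_system T) {FF : ProperFilter F}
    (f : T -> R) (l l' : R) : f @ F --> l -> f @ F --> l' -> l = l'.
Proof. by move=> fl fl'; exact: (cvg_unique _ fl fl'). Qed.

Lemma cvg_sum_ord (R : realType) (T : Type) (F : set_system T) {FF : Filter F} (N : nat)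
    (f : 'I_N -> T -> R) (l : 'I_N -> R) :
  (forall i, f i @ F --> l i) -> (fun t => \sum_i f i t) @ F --> \sum_i l i.
Proof.
move=> h; elim: (index_enum _) => [|i s ih].
  by rewrite big_nil; under eq_cvg do rewrite big_nil; exact: cvg_cst.
by rewrite big_cons; under eq_cvg do rewrite big_cons; exact: cvgD.
Qed.

(** Plays the role of weak compactness of balls: each scalar limit exists by compactness of a
    segment, and the limits depend linearly and boundedly on [h]. *)
Lemma weak_ultra_cvg (R : realType) (H : completeNormedModType R) (ip : H -> H -> R)
    (T : Type) (U : set_system T) (u : T -> H) (M : R) :
  is_inner_product ip -> UltraFilter U -> (forall t, `|u t| <= M) ->
  exists l, forall h, (fun t => ip (u t) h) @ U --> ip l h.
Proof.
move=> hip UU uM.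
have bnd h t : `|ip (u t) h| <= M * `|h|.
  by apply: le_trans (normr_ip hip _ _) _; rewrite ler_wpM2r.
have ex h : exists l : R, (fun t => ip (u t) h) @ U --> l.
  exact: (bounded_ultra_cvg UU (bnd h)).
have [g hg] := choice ex.
have [|||l hl] := @riesz _ _ _ hip g.
- move=> x y; have := hg (x + y).
  have -> : (fun t => ip (u t) (x + y)) = (fun t => ip (u t) x + ip (u t) y).
    by apply/funext => t; rewrite (ipDr hip).
  by move=> c; exact: (cvg_unique _ c (cvgD (hg x) (hg y))).
- move=> a x; have := hg (a *: x).
  have -> : (fun t => ip (u t) (a *: x)) = (fun t => a * ip (u t) x).
    by apply/funext => t; rewrite (ipZr hip).
  by move=> c; exact: (cvg_unique _ c (cvgMl_tmp (a := a) (hg x))).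
- exists M => x; rewrite -subr_ge0.
  apply: (@cvg_ge0 _ _ U _ (fun t => M * `|x| - `|ip (u t) x|)).
    by move=> t; rewrite subr_ge0.
  by apply: cvgB; [exact: cvg_cst|exact: cvg_norm].
by exists l => h; rewrite -hl.
Qed.

Lemma cvg0_of_sqr (R : realType) (T : Type) (F : set_system T) (FF : Filter F) (f : T -> R) :
  (fun t => f t ^+ 2) @ F --> (0 : R) -> f @ F --> (0 : R).
Proof.
move=> h; apply/norm_cvg0P.
have -> : (fun t => `|f t|) = (fun t => Num.sqrt (f t ^+ 2)).
  by apply/funext => t; rewrite sqrtr_sqr.
have sqrt0 : @Num.sqrt R @ (0 : R) --> (0 : R).
  by rewrite -[in X in _ --> X](@sqrtr0 R); exact: sqrt_continuous.
exact: (cvg_comp _ _ h sqrt0).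
Qed.

Lemma ip_cvg0 (R : realType) (H : completeNormedModType R) (ip : H -> H -> R)
    (T : Type) (F : set_system T) (FF : Filter F) (f g : T -> H) (M : R) :
  is_inner_product ip -> (forall t, `|f t| <= M) ->
  (fun t => `|g t|) @ F --> (0 : R) -> (fun t => ip (f t) (g t)) @ F --> (0 : R).
Proof.
move=> hip fM g0; apply/norm_cvg0P.
apply: (@squeeze_cvgr _ _ _ _ (fun=> 0) (fun t => M * `|g t|)).
- apply: nearW => t; rewrite normr_ge0 /=.
  by apply: le_trans (normr_ip hip _ _) _; rewrite ler_wpM2r.
- exact: cvg_cst.
- by rewrite -(mulr0 M); exact: cvgMl_tmp.
Qed.

(** * Matrices acting on the product space *)

Section QuadraticForms.
Variables (R : realType) (H : completeNormedModType R) (ip : H -> H -> R).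
Hypothesis hip : is_inner_product ip.
Let ipE := ipE hip.

Lemma ip_suml (N : nat) (x : 'I_N -> H) (y : H) : ip (\sum_i x i) y = \sum_i ip (x i) y.
Proof.
elim: (index_enum _) => [|i s ih]; first by rewrite !big_nil (ip0l hip).
by rewrite !big_cons (ipDl hip) ih.
Qed.

Lemma ip_sumr (N : nat) (x : 'I_N -> H) (y : H) : ip y (\sum_i x i) = \sum_i ip y (x i).
Proof. by rewrite (ipC hip) ip_suml; apply: eq_bigr => i _; rewrite (ipC hip). Qed.

(** The quadratic form of the Kronecker product of [M] with the identity of [H]. For [H = R^o] with
    multiplication it is the ordinary form of [M], so one set of recursion lemmas serves both. *)
Definition qform (N : nat) (M : 'I_N -> 'I_N -> R) (x : 'I_N -> H) : R :=
  \sum_i \sum_j M i j * ip (x i) (x j).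

Lemma qform_recl (N : nat) (M : 'I_N.+1 -> 'I_N.+1 -> R) (x : 'I_N.+1 -> H) :
  (forall i j, M i j = M j i) ->
  qform M x = M ord0 ord0 * ip (x ord0) (x ord0)
    + 2 * \sum_i M ord0 (lift ord0 i) * ip (x ord0) (x (lift ord0 i))
    + qform (fun i j => M (lift ord0 i) (lift ord0 j)) (fun i => x (lift ord0 i)).
Proof.
move=> sM; rewrite /qform big_ord_recl big_ord_recl.
under [X in _ + X = _]eq_bigr do rewrite big_ord_recl sM (ipC hip).
rewrite big_split /=; ring.
Qed.

Lemma qform_schur (N : nat) (M : 'I_N.+1 -> 'I_N.+1 -> R) (x : 'I_N.+1 -> H) :
  (forall i j, M i j = M j i) -> M ord0 ord0 != 0 ->
  let a := M ord0 ord0 in let b i := M ord0 (lift ord0 i) in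
  let s := \sum_i (b i / a) *: x (lift ord0 i) in
  qform M x = a * ip (x ord0 + s) (x ord0 + s)
    + qform (fun i j => M (lift ord0 i) (lift ord0 j) - b i * b j / a)
            (fun i => x (lift ord0 i)).
Proof.
move=> sM a0 a b s; rewrite qform_recl// -/a.
have e1 : a * ip (x ord0) s = \sum_i b i * ip (x ord0) (x (lift ord0 i)).
  rewrite ip_sumr mulr_sumr; apply: eq_bigr => i _; rewrite (ipZr hip).
  by field.
have e2 : a * ip s s = qform (fun i j => b i * b j / a) (fun i => x (lift ord0 i)).
  rewrite ip_suml mulr_sumr; apply: eq_bigr => i _.
  rewrite ip_sumr mulr_sumr; apply: eq_bigr => j _; rewrite !ipE.
  by field.
have e3 : qform (fun i j => M (lift ord0 i) (lift ord0 j) - b i * b j / a)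
            (fun i => x (lift ord0 i))
   = qform (fun i j => M (lift ord0 i) (lift ord0 j)) (fun i => x (lift ord0 i))
     - qform (fun i j => b i * b j / a) (fun i => x (lift ord0 i)).
  rewrite -sumrB; apply: eq_bigr => i _; rewrite -sumrB; apply: eq_bigr => j _.
  by rewrite mulrBl.
rewrite e3 -e2 -e1 !ipE (ipC hip s); ring.
Qed.

End QuadraticForms.

Lemma mul_inner_product (R : realType) :
  @is_inner_product R R^o (fun x y : R => x * y).
Proof.
split=> [x y|a x y z|x]; [exact: mulrC|by rewrite mulrDl -mulrA|].
by rewrite -expr2 real_normK// num_real.
Qed.

(* Eliminates the variables one at a time by completing squares. *)
Lemma qform_ge0 (R : realType) (H : completeNormedModType R) (ip : H -> H -> R) (N : nat)
    (M : 'I_N -> 'I_N -> R) (x : 'I_N -> H) :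
  is_inner_product ip -> (forall i j, M i j = M j i) ->
  (forall v : 'I_N -> R^o, 0 <= qform (fun x y : R => x * y) M v) -> 0 <= qform ip M x.
Proof.
move=> hip; elim: N M x => [|N ih] M x sM psd; first by rewrite /qform big_ord0.
have hR := mul_inner_product R.
pose cons (a : R^o) (v : 'I_N -> R^o) (i : 'I_N.+1) : R^o := oapp v a (unlift ord0 i).
have cons0 a v : cons a v ord0 = a by rewrite /cons unlift_none.
have consS a v i : cons a v (lift ord0 i) = v i by rewrite /cons liftK.
have a0 : 0 <= M ord0 ord0.
  have := psd (cons 1 (fun=> 0)); rewrite (qform_recl hR)// cons0 /qform.
  rewrite big1 => [|i _]; last by rewrite consS !mulr0.
  rewrite big1 => [|i _]; last by rewrite big1// => j _; rewrite !consS !mulr0.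
  by rewrite !mulr1 mulr0 !addr0.
have sM' i j : M (lift ord0 i) (lift ord0 j) = M (lift ord0 j) (lift ord0 i) by exact: sM.
have [a0'|a_neq0] := eqVneq (M ord0 ord0) 0; last first.
  rewrite (qform_schur hip)//; apply: addr_ge0.
    by apply: mulr_ge0 => //; exact: ipxx_ge0.
  apply: ih => [i j|v]; first by rewrite sM' (mulrC (M ord0 _)).
  (* Putting [- s] in the eliminated coordinate annihilates the square, so the Schur complement
     inherits nonnegativity on scalars. *)
  pose s := \sum_i (M ord0 (lift ord0 i) / M ord0 ord0) *: v i.
  have := psd (cons (- s) v); rewrite (qform_schur hR)//.
  rewrite (_ : cons _ _ ord0 + _ = 0); last first.
    by rewrite cons0; under eq_bigr do rewrite consS; rewrite addNr.
  rewrite mulr0 mulr0 add0r /qform.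
  by under eq_bigr do under eq_bigr do rewrite !consS.
(* With a zero pivot the form is affine in the first coordinate [t]; being nonnegative for all [t],
   it has no linear term. *)
have b0 i : M ord0 (lift ord0 i) = 0.
  pose b := M ord0 (lift ord0 i).
  have h (t : R) : 0 <= 2 * (t * b) + M (lift ord0 i) (lift ord0 i).
    have := psd (cons t (fun j => (j == i)%:R)); rewrite (qform_recl hR)// a0' mul0r add0r.
    rewrite cons0 /qform (bigD1 i)//= big1 => [|j /negPf ji]; last first.
      by rewrite consS ji !mulr0.
    rewrite (bigD1 i)//= (bigD1 i)//= !consS eqxx big1 => [|j /negPf ji]; last first.
      by rewrite consS ji !mulr0.
    rewrite big1 => [|j /negPf ji]; last first.
      by apply: big1 => k _; rewrite !consS ji mul0r mulr0.
    by rewrite !mulr1 !addr0 (mulrC _ t).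
  apply/eqP/negPn/negP => bn0.
  have := h (- (M (lift ord0 i) (lift ord0 i) + 1) / (2 * b)).
  rewrite (_ : 2 * _ + _ = -1); last by rewrite /b in bn0 *; field.
  lra.
rewrite (qform_recl hip)// a0' mul0r add0r big1 ?mulr0 ?add0r => [|i _]; last first.
  by rewrite b0 mul0r.
apply: ih => // v; have := psd (cons 0 v).
rewrite (qform_recl hR)// a0' mul0r add0r big1 ?mulr0 ?add0r => [|i _]; last first.
  by rewrite b0 mul0r.
by rewrite /qform; under eq_bigr do under eq_bigr do rewrite !consS.
Qed.

Section MatrixAction.
Variables (R : realType) (H : completeNormedModType R) (ip : H -> H -> R).
Hypothesis hip : is_inner_product ip.
Let ipE := ipE hip.
Variable N : nat.
Implicit Types (M : 'M[R]_N) (x y : 'I_N -> H).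

Lemma mxactM M1 M2 x : mxact (M1 *m M2) x = mxact M1 (mxact M2 x).
Proof.
apply/funext => i; rewrite /mxact.
under [RHS]eq_bigr do rewrite scaler_sumr.
rewrite exchange_big /=; apply: eq_bigr => j _.
by rewrite mxE scaler_suml; apply: eq_bigr => k _; rewrite scalerA.
Qed.

Lemma mxactB M1 M2 x i : mxact (M1 - M2) x i = mxact M1 x i - mxact M2 x i.
Proof. by rewrite /mxact -sumrB; apply: eq_bigr => j _; rewrite !mxE scalerBl. Qed.

Lemma mxact1 x : mxact 1%:M x = x.
Proof.
apply/funext => i; rewrite /mxact (bigD1 i)//= big1 => [|j /negPf ji].
  by rewrite mxE eqxx scale1r addr0.
by rewrite mxE eq_sym ji scale0r.
Qed.

Lemma mxact_diag (a : 'I_N -> R) x i : mxact (diag_mx (\row_j a j)) x i = a i *: x i.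
Proof.
rewrite /mxact (bigD1 i)//= big1 => [|j /negPf ji].
  by rewrite !mxE eqxx mulr1n addr0.
by rewrite !mxE eq_sym ji mulr0n scale0r.
Qed.

Lemma prod_ip_mxact M x y : prod_ip ip x (mxact M y) = prod_ip ip (mxact M^T x) y.
Proof.
rewrite /prod_ip /mxact.
under eq_bigr do rewrite (ip_sumr hip).
under [RHS]eq_bigr do rewrite (ip_suml hip).
rewrite exchange_big /=; apply: eq_bigr => j _; apply: eq_bigr => i _.
by rewrite mxE !ipE.
Qed.

Lemma prod_ip_psd M x : M^T = M -> mx_psd M -> 0 <= prod_ip ip x (mxact M x).
Proof.
move=> sM pM.
have -> : prod_ip ip x (mxact M x) = qform ip (fun i j => M i j) x.
  apply: eq_bigr => i _; rewrite (ip_sumr hip); apply: eq_bigr => j _.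
  by rewrite (ipZr hip).
apply: qform_ge0 => // [i j|v]; first by rewrite -[in LHS]sM mxE.
have := pM (\col_i v i).
rewrite -mulmxA mxE (_ : \sum_j _ = qform (fun x y : R => x * y) (fun i j => M i j) v)//.
apply: eq_bigr => i _; rewrite !mxE mulr_sumr; apply: eq_bigr => j _.
by rewrite !mxE mulrCA.
Qed.

End MatrixAction.

Section OperatorNorm.
Variables (R : realType) (N : nat).
Implicit Types (M : 'M[R]_N) (v : 'cV[R]_N).

Lemma vnormE v : vnorm v ^+ 2 = (v^T *m v) 0 0.
Proof.
rewrite sqr_sqrtr; last by apply: sumr_ge0 => i _; exact: sqr_ge0.
by rewrite mxE; apply: eq_bigr => i _; rewrite mxE expr2.
Qed.

Lemma vnorm_ge0 v : 0 <= vnorm v.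
Proof. exact: sqrtr_ge0. Qed.

Lemma vnormZ (a : R) v : vnorm (a *: v) = `|a| * vnorm v.
Proof.
rewrite /vnorm -sqrtr_sqr -sqrtrM ?sqr_ge0//; congr Num.sqrt.
by rewrite mulr_sumr; apply: eq_bigr => i _; rewrite mxE exprMn.
Qed.

Lemma vnorm_eq0 v : vnorm v = 0 -> v = 0.
Proof.
move=> /eqP; rewrite sqrtr_eq0 => h.
have /eqP : \sum_i v i 0 ^+ 2 = 0.
  by apply/eqP; rewrite eq_le h; apply: sumr_ge0 => i _; exact: sqr_ge0.
rewrite psumr_eq0 => [/allP v0|i _]; last exact: sqr_ge0.
apply/matrixP => i j; rewrite ord1 mxE.
by apply/eqP; rewrite -sqrf_eq0; exact: (v0 i (mem_index_enum i)).
Qed.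

(** Needed because [sup] bounds its set only when that set is bounded above. Entries of a vector in
    the unit ball have absolute value at most 1, so absolute row sums give a bound. *)
Lemma mx_opnorm_ubound M : has_ubound [set vnorm (M *m v) | v in [set v | vnorm v <= 1]].
Proof.
exists (Num.sqrt (\sum_i (\sum_j `|M i j|) ^+ 2)) => _ [v /= v1 <-].
rewrite ler_sqrt; last by apply: sumr_ge0 => i _; exact: sqr_ge0.
apply: ler_sum => i _; rewrite -[X in X <= _]real_normK ?num_real// ler_sqr ?nnegrE//; last first.
  by apply: sumr_ge0.
rewrite mxE; apply: le_trans (ler_norm_sum _ _ _) _; apply: ler_sum => j _.
rewrite normrM -[X in _ <= X]mulr1 ler_wpM2l//.
apply: le_trans v1; rewrite -sqrtr_sqr ler_wsqrtr// (bigD1 j)//= lerDl.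
by apply: sumr_ge0 => k _; exact: sqr_ge0.
Qed.

Lemma vnorm_mulmx M v : vnorm (M *m v) <= mx_opnorm M * vnorm v.
Proof.
have [v0|v0] := eqVneq (vnorm v) 0.
  by rewrite (vnorm_eq0 v0) mulmx0 -(scale0r 0) vnormZ normr0 mul0r mulr0.
have vp : 0 < vnorm v by rewrite lt_def v0 vnorm_ge0.
rewrite -ler_pdivrMr//.
apply: ub_le_sup; first exact: mx_opnorm_ubound.
exists ((vnorm v)^-1 *: v); first by rewrite /= vnormZ gtr0_norm ?invr_gt0// mulVf.
by rewrite -scalemxAr vnormZ gtr0_norm ?invr_gt0// mulrC.
Qed.

(** Expand the square of [v - M v]: twice the form is at most [|v|^2 + |M v|^2]. *)
Lemma quadratic_le_of_vnorm_le M v : vnorm (M *m v) <= vnorm v ->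
  (v^T *m M *m v) 0 0 <= (v^T *m v) 0 0.
Proof.
move=> le; have := vnormE (v - M *m v).
have := sqr_ge0 (vnorm (v - M *m v)).
have h2 : vnorm (M *m v) ^+ 2 <= vnorm v ^+ 2 by rewrite ler_sqr ?nnegrE ?vnorm_ge0.
rewrite !vnormE in h2.
have sw : ((M *m v)^T *m v) 0 0 = (v^T *m M *m v) 0 0.
  by rewrite -(trmxK ((M *m v)^T *m v)) mxE trmx_mul trmxK mulmxA.
move=> h0 e; rewrite e in h0; move: h0.
have mxB (A B : 'M[R]_1) : (A - B) 0 0 = A 0 0 - B 0 0 by rewrite !mxE.
rewrite [(_ - _)^T]linearB /= mulmxBl !mulmxBr !mxB mulmxA sw; lra.
Qed.

End OperatorNorm.

(** * The dual metric built from the mixing matrix and the step sizes *)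

Section DualMetric.
Variables (R : realType) (N : nat).
Implicit Types D M : 'M[R]_N.

(** Testing [D] at [v - Lam D v] avoids a square root of [D]: with [p = Lamh D v] it gives [v^T D v
    - 2 |p|^2 + p^T (Lamh D Lamh) p >= 0], whose last term is at most [|p|^2]. *)
Lemma stepsize_psd D (alpha : 'I_N -> R) :
  let Lam := diag_mx (\row_i alpha i) in
  let Lamh := diag_mx (\row_i Num.sqrt (alpha i)) in
  D^T = D -> mx_psd D -> (forall i, 0 < alpha i) ->
  (forall v, vnorm (Lamh *m D *m Lamh *m v) <= vnorm v) ->
  mx_psd (D - D *m Lam *m D).
Proof.
move=> Lam Lamh sD pD a0 hS v.
have sL : Lamh^T = Lamh by exact: tr_diag_mx.
have LE : Lam = Lamh *m Lamh.
  rewrite mulmx_diag; congr diag_mx; apply/rowP => i; rewrite !mxE -expr2 sqr_sqrtr//.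
  exact: ltW.
pose p := Lamh *m D *m v.
have pT : p^T = v^T *m D *m Lamh by rewrite /p !trmx_mul sD sL mulmxA.
have := quadratic_le_of_vnorm_le (hS p).
have := pD (v - Lamh *m p).
have mxB (A B : 'M[R]_1) : (A - B) 0 0 = A 0 0 - B 0 0 by rewrite !mxE.
have e1 : (v^T *m (D - D *m Lam *m D) *m v) 0 0 = (v^T *m D *m v) 0 0 - (p^T *m p) 0 0.
  by rewrite mulmxBr mulmxBl mxB LE pT /p !mulmxA.
have e2 : ((v - Lamh *m p)^T *m D *m (v - Lamh *m p)) 0 0 =
   (v^T *m D *m v) 0 0 - 2 * (p^T *m p) 0 0 + (p^T *m (Lamh *m D *m Lamh) *m p) 0 0.
  have t1 : v^T *m D *m (Lamh *m p) = p^T *m p by rewrite pT !mulmxA.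
  have t2 : (Lamh *m p)^T *m D *m v = p^T *m p by rewrite trmx_mul sL /p !mulmxA.
  have t3 : (Lamh *m p)^T *m D *m (Lamh *m p) = p^T *m (Lamh *m D *m Lamh) *m p.
    by rewrite trmx_mul sL !mulmxA.
  rewrite [(_ - _)^T]linearB /= !mulmxBl !mulmxBr !mxB t1 t2 t3; ring.
rewrite e1 e2; lra.
Qed.

Lemma pseudo_inverse D :
  (0 < N)%N -> D^T = D ->
  (forall v : 'cV[R]_N, D *m v = 0 <-> exists c : R, v = c *: const_mx 1) ->
  exists Y : 'M[R]_N, Y^T = Y /\ D *m Y = 1%:M - N%:R^-1 *: const_mx 1.
Proof.
move=> N0 sD kD; pose P : 'M[R]_N := 1%:M - N%:R^-1 *: const_mx 1.
have sP : P^T = P.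
  by rewrite /P linearB /= linearZ /= trmx1 trmx_const.
have D1 : D *m const_mx 1 = 0 :> 'cV[R]_N by apply/kD; exists 1; rewrite scale1r.
have one_mul (v : 'cV[R]_N) : const_mx 1 *m v = const_mx (\sum_j v j 0) :> 'cV[R]_N.
  apply/matrixP => i j; rewrite !mxE; apply: eq_bigr => k _.
  by rewrite mxE mul1r ord1.
have N_neq0 : N%:R != 0 :> R by rewrite pnatr_eq0 -lt0n.
have P1 : P *m const_mx 1 = 0 :> 'cV[R]_N.
  rewrite mulmxBl mul1mx -scalemxAl one_mul.
  apply/matrixP => i j; rewrite !mxE.
  under eq_bigr do rewrite mxE.
  by rewrite sumr_const card_ord mulVf// subrr.
have DP : D *m P = D.
  rewrite mulmxBr mulmx1 -scalemxAr (_ : D *m const_mx 1 = 0) ?scaler0 ?subr0//.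
  apply/matrixP => i j; have := congr1 (fun M : 'cV[R]_N => M i 0) D1; rewrite !mxE => e.
  by rewrite -[RHS]e; apply: eq_bigr => k _; rewrite !mxE.
(* Row space inclusion is tested on the cokernel of [D]: its columns lie in [ker D], spanned by the
   all-ones vector, which [P] kills. *)
have sub : (P <= D)%MS.
  rewrite submxE; apply/eqP/matrixP => i j.
  have : D *m col j (cokermx D) = 0.
    by rewrite colE mulmxA mulmx_coker mul0mx.
  move=> /kD[c e].
  have : P *m col j (cokermx D) = 0 by rewrite e -scalemxAr P1 scaler0.
  by rewrite colE mulmxA -colE => /matrixP/(_ i 0); rewrite mxE [RHS]mxE => ->; rewrite mxE.
pose X := P *m pinvmx D.
have XD : X *m D = P by exact: mulmxKpV.
have DX : D *m X^T = P by rewrite -[in LHS]sD -trmx_mul XD.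
(* [X] itself need not be symmetric, but [P *m X^T = X *m D *m X^T] is. *)
exists (P *m X^T); split; last by rewrite mulmxA DP.
by rewrite trmx_mul trmxK sP -{1}DX mulmxA XD.
Qed.

(* With [D = (beta/2)(I-W)] and [Y] an inverse of [D] on the vectors of zero sum,
   [Q = Y - Lam] is the metric in which the dual iterates are Fejer monotone. *)
Lemma dual_metric (H : completeNormedModType R) (ip : H -> H -> R)
    D (alpha : 'I_N -> R) :
  let Lam := diag_mx (\row_i alpha i) in
  is_inner_product ip -> (0 < N)%N -> D^T = D ->
  (forall v : 'cV[R]_N, D *m v = 0 <-> exists c : R, v = c *: const_mx 1) ->
  mx_psd (D - D *m Lam *m D) ->
  exists Q : 'M[R]_N, [/\ Q^T = Q,
    forall w : 'I_N -> H, \sum_i w i = 0 -> 0 <= prod_ip ip w (mxact Q w),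
    forall t : 'I_N -> H, \sum_i mxact D t i = 0 &
    forall y d h : 'I_N -> H, d = mxact D (fun j => y j + alpha j *: d j) ->
      \sum_i h i = 0 -> prod_ip ip h y = prod_ip ip h (mxact Q d)].
Proof.
move=> Lam hip N0 sD kD pG.
have [Y [sY DY]] := pseudo_inverse N0 sD kD.
have DYh (h : 'I_N -> H) : \sum_i h i = 0 -> mxact D (mxact Y h) = h.
  move=> h0; rewrite -mxactM DY; apply/funext => i; rewrite mxactB mxact1.
  rewrite /mxact (_ : \sum_j _ = N%:R^-1 *: \sum_j h j); first by rewrite h0 scaler0 subr0.
  by rewrite scaler_sumr; apply: eq_bigr => j _; rewrite !mxE mulr1.
have prodB (x : 'I_N -> H) M1 M2 (y : 'I_N -> H) :
    prod_ip ip x (mxact (M1 - M2) y) = prod_ip ip x (mxact M1 y) - prod_ip ip x (mxact M2 y).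
  rewrite /prod_ip -sumrB; apply: eq_bigr => i _.
  by rewrite mxactB (ipDr hip) (ipNr hip).
have sLam : Lam^T = Lam by exact: tr_diag_mx.
exists (Y - Lam); split.
- by rewrite linearB /= sY sLam.
(* Since [w = D Y w], the form of [Y - Lam] at [w] is that of [D - D Lam D] at [Y w]. *)
- move=> w w0; have := prod_ip_psd hip (mxact Y w) _ pG.
  rewrite linearB /= !trmx_mul sD sLam mulmxA => /(_ erefl).
  rewrite !prodB (mxactM (D *m Lam) D) DYh// (mxactM D Lam).
  by rewrite [X in _ - X](prod_ip_mxact hip D) sD DYh// (prod_ip_mxact hip Y w) sY.
- move=> t; rewrite /mxact exchange_big /=; apply: big1 => j _.
  rewrite -scaler_suml (_ : \sum_i D i j = 0) ?scale0r//.
  have D1 : D *m const_mx 1 = 0 :> 'cV[R]_N by apply/kD; exists 1; rewrite scale1r.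
  have := congr1 (fun M : 'cV[R]_N => M j 0) D1; rewrite !mxE => e.
  by rewrite -[RHS]e; apply: eq_bigr => k _; rewrite !mxE mulr1 -[in LHS]sD mxE.
(* Move [Y] onto [h] and apply [D]: on zero-sum vectors [<h, Y d> = <D Y h, y + Lam d> = <h, y + Lam
   d>], and subtracting [<h, Lam d>] leaves [<h, y>]. *)
- move=> y d h dE h0; rewrite prodB.
  have -> : prod_ip ip h (mxact Y d) = prod_ip ip h (fun j => y j + alpha j *: d j).
    rewrite prod_ip_mxact// sY {1}dE prod_ip_mxact// sD DYh//.
  rewrite /prod_ip -sumrB; apply: eq_bigr => i _.
  by rewrite mxact_diag (ipDr hip) addrK.
Qed.

End DualMetric.

(** * Lyapunov analysis *)

Section StepEstimates.
Variables (R : realType) (H : completeNormedModType R) (ip : H -> H -> R).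
Hypothesis hip : is_inner_product ip.
Let ipE := ipE hip.
Let nsq (x : H) : R := ip x x.

(** After centering at the saddle point, the right side minus the left is exactly twice the sum of
    the two monotonicity products in the hypotheses. *)
Lemma descent_step (a : R) (x z zn y by_ v w xs zs bs ws : H) :
  zn = x - a *: (v + w) -> y = x + zn - z -> zs = xs - a *: (bs + ws) ->
  0 <= ip (x - xs) ((z - x) - (zs - xs)) -> 0 <= a * ip (y - xs) (by_ - bs) ->
  nsq (zn - zs) + nsq (zn - z) + 2 * a * ip (w - ws) (y - xs)
    <= nsq (z - zs) + 2 * a * ip (y - xs) (by_ - v).
Proof.
move=> znE yE zsE hA hB.
have aw : a *: w = x - zn - a *: v by apply: (ip_ext hip) => h; rewrite znE !ipE; ring.
have aws : a *: ws = xs - zs - a *: bs by apply: (ip_ext hip) => h; rewrite zsE !ipE; ring.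
pose X := x - xs; pose Z := z - zs; pose Y := y - xs.
have e1 : zn - z = Y - X by apply: (ip_ext hip) => h; rewrite /Y /X yE !ipE; ring.
have e2 : zn - zs = Y - X + Z by apply: (ip_ext hip) => h; rewrite /Y /X /Z yE !ipE; ring.
have e3 : (z - x) - (zs - xs) = Z - X by apply: (ip_ext hip) => h; rewrite /X /Z !ipE; ring.
have e4 : a *: (w - ws) = 2 *: X - Y - Z - a *: (v - bs).
  rewrite scalerBr aw aws; apply: (ip_ext hip) => h; rewrite /Y /X /Z yE !ipE; ring.
have e5 : 2 * a * ip (w - ws) Y = 2 * ip (a *: (w - ws)) Y by rewrite (ipZl hip) mulrA.
rewrite e3 -/X in hA; rewrite -/Y -/Z e5 e4 e2 e1 /nsq; move: hA hB; rewrite -/Y.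
clear e1 e2 e3 e4 e5; clearbody X Y Z.
rewrite !ipE (ipC hip Y X) (ipC hip Z X) (ipC hip Z Y).
rewrite (ipC hip v Y) (ipC hip bs Y); nra.
Qed.

(** The hypothesis is firm nonexpansiveness of the resolvent; the conclusion is nonexpansiveness of
    its complement [I - J]. *)
Lemma firm_residual_le (x z x1 z1 : H) :
  0 <= ip (x - x1) ((z - x) - (z1 - x1)) ->
  nsq ((x - x1) - (z - z1)) <= nsq (z - z1).
Proof.
have -> : (z - x) - (z1 - x1) = (z - z1) - (x - x1).
  by apply: (ip_ext hip) => h; rewrite !ipE; ring.
move: (x - x1) (z - z1) => p q; rewrite /nsq !ipE (ipC hip q p).
have := ipxx_ge0 hip p; lra.
Qed.

Lemma nsqD_le (p q : H) : nsq (p + q) <= 2 * nsq p + 2 * nsq q.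
Proof.
by have := ipxx_ge0 hip (p - q); rewrite /nsq !ipE (ipC hip q p); lra.
Qed.

Lemma nsqB_le (p q : H) : nsq (p - q) <= 2 * nsq p + 2 * nsq q.
Proof.
by have := ipxx_ge0 hip (p + q); rewrite /nsq !ipE (ipC hip q p); lra.
Qed.

Lemma ip_lipschitz_le (l : R) (r p q : H) :
  0 < l -> `|p| <= l * `|q| -> 2 * ip r p <= l * (nsq r + nsq q).
Proof.
move=> l0 h; apply: le_trans (ip_young hip r p l0) _.
rewrite mulrDr lerD2l mulrC ler_pdivrMr// /nsq !(ipxx hip).
apply: le_trans (_ : (l * `|q|) ^+ 2 <= _); last by rewrite exprMn expr2 -mulrA mulrC.
by rewrite ler_sqr ?nnegrE// mulr_ge0// ltW.
Qed.

End StepEstimates.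

(** * The scheme in primal-dual form *)

Section Iteration.
Variables (R : realType) (H : completeNormedModType R) (ip : H -> H -> R).
Hypothesis hip : is_inner_product ip.
Let ipE := ipE hip.
Let nsq (x : H) : R := ip x x.
Variable N : nat.
Variables (A : 'I_N -> H -> set H) (B : 'I_N -> H -> H) (L alpha : 'I_N -> R) (c : R).
Variables (Q : 'M[R]_N) (x y z v w : nat -> 'I_N -> H).
Hypothesis mA : forall i, maximally_monotone ip (A i).
Hypothesis mB : forall i, monotone_fun ip (B i).
Hypothesis lB : forall i, lipschitz_with (L i) (B i).
Hypothesis L0 : forall i, 0 < L i.
Hypothesis a0 : forall i, 0 < alpha i.
Hypothesis c0 : 0 <= c.
Hypothesis c1 : c < 1.
Hypothesis Lc : forall i, alpha i * L i <= c / 8.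
Hypothesis xE : forall k i, x k i = resolvent (alpha i) (A i) (z k i).
Hypothesis zE : forall k i, z k.+1 i = x k i - alpha i *: (v k i + w k i).
Hypothesis yE : forall k i, y k.+1 i = x k i + z k.+1 i - z k i.
Hypothesis vE : forall k i, v k.+1 i = 2 *: B i (y k.+1 i) - B i (y k i).
Hypothesis sQ : Q^T = Q.
Hypothesis pQ : forall h : 'I_N -> H, \sum_i h i = 0 -> 0 <= prod_ip ip h (mxact Q h).
Hypothesis sw : forall k, \sum_i w k i = 0.
(** The mixing matrix enters the analysis only here and through the hypotheses on [Q] and on the
    sums of [w]. *)
Hypothesis dual : forall k (h : 'I_N -> H), \sum_i h i = 0 ->
  prod_ip ip h (y k.+2) = prod_ip ip h (mxact Q (fun i => w k.+1 i - w k i)).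

Definition qd (f g : 'I_N -> H) : R := prod_ip ip f (mxact Q g).

Lemma qdC f g : qd f g = qd g f.
Proof.
rewrite /qd prod_ip_mxact// sQ; apply: eq_bigr => i _; exact: ipC.
Qed.

Lemma qdBl f g h : qd (fun i => f i - g i) h = qd f h - qd g h.
Proof. by rewrite /qd /prod_ip -sumrB; apply: eq_bigr => i _; rewrite !ipE. Qed.

Lemma qdBr f g h : qd h (fun i => f i - g i) = qd h f - qd h g.
Proof. by rewrite qdC qdBl !(qdC _ h). Qed.

Lemma qdZl (t : R) f g : qd (fun i => t *: f i) g = t * qd f g.
Proof. by rewrite /qd /prod_ip mulr_sumr; apply: eq_bigr => i _; rewrite !ipE. Qed.

Lemma qd_polar f g :
  2 * qd f g = qd f f + qd g g - qd (fun i => f i - g i) (fun i => f i - g i).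
Proof. rewrite qdBl !qdBr (qdC g f); ring. Qed.

Lemma qd_cauchy_schwarz f g : \sum_i f i = 0 -> \sum_i g i = 0 ->
  qd f g ^+ 2 <= qd f f * qd g g.
Proof.
move=> f0 g0.
have h t : 0 <= qd f f - 2 * (t * qd f g) + t ^+ 2 * qd g g.
  have : 0 <= qd (fun i => f i - t *: g i) (fun i => f i - t *: g i).
    apply: pQ; rewrite sumrB f0 -scaler_sumr g0 scaler0 subrr//.
  rewrite qdBl !qdBr !qdZl !(qdC _ (fun i => t *: g i)) !qdZl (qdC g f).
  by congr (0 <= _); ring.
have g_ge0 : 0 <= qd g g by exact: pQ.
have [g_eq0|g_neq0] := eqVneq (qd g g) 0.
  have [->|b0] := eqVneq (qd f g) 0; first by rewrite g_eq0 mulr0 expr0n.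
  (* In the degenerate case the bound is affine in [t]; this value makes it -1. *)
  have := h ((qd f f + 1) / (2 * qd f g)); rewrite g_eq0 mulr0 addr0.
  rewrite (_ : 2 * _ = qd f f + 1); [lra|by field].
have gp : 0 < qd g g by rewrite lt_def g_neq0.
have := h (qd f g / qd g g); rewrite -(pmulr_lge0 _ gp) => le0.
by rewrite -subr_ge0; apply: le_trans le0 _; rewrite le_eqVlt; apply/orP; left; apply/eqP; field.
Qed.

(** Eliminating [zs] leaves [u_i + B_i xs + ws_i = 0] with [u_i] in [A_i xs]. Summation makes [xs] a
    zero of the sum, and every zero arises in this way. *)
Definition is_saddle (xs : H) (zs ws : 'I_N -> H) :=
  [/\ forall i, A i xs ((alpha i)^-1 *: (zs i - xs)),
      forall i, zs i = xs - alpha i *: (B i xs + ws i)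
    & \sum_i ws i = 0].

Lemma resolvent_monotone k i p u : A i p u ->
  0 <= ip (x k i - p) ((z k i - x k i) - alpha i *: u).
Proof.
move=> Au; have := resolventP hip (z k i) (mA i) (a0 i); rewrite -xE => Ax.
have := (mA i).1 _ _ _ _ Ax Au.
have -> : (z k i - x k i) - alpha i *: u =
    alpha i *: ((alpha i)^-1 *: (z k i - x k i) - u).
  by rewrite scalerBr scalerA mulfV ?gt_eqF// scale1r.
by move=> h; rewrite (ipZr hip) pmulr_rge0.
Qed.

Lemma resolvent_monotone_iter k l i :
  0 <= ip (x k i - x l i) ((z k i - x k i) - (z l i - x l i)).
Proof.
have := resolventP hip (z l i) (mA i) (a0 i); rewrite -xE => Ax.
have := resolvent_monotone k Ax.
by rewrite scalerA mulfV ?gt_eqF// scale1r.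
Qed.

Let dz k i := z k.+1 i - z k i.

(** Lipschitz errors live on increments of [y], descent on increments of [z]; nonexpansiveness of
    [I - J] links them. Indices start at [y^1] because [y^0] is arbitrary. *)
Lemma dy_le k i :
  nsq (y k.+2 i - y k.+1 i) <= 2 * nsq (dz k.+1 i) + 2 * nsq (dz k i).
Proof.
have -> : y k.+2 i - y k.+1 i = dz k.+1 i + ((x k.+1 i - x k i) - (z k.+1 i - z k i)).
  by rewrite !yE /dz; apply: (ip_ext hip) => h; rewrite !ipE; ring.
apply: le_trans (nsqD_le hip _ _) _; rewrite lerD2l ler_pM2l ?ltr0Sn//.
exact: firm_residual_le (resolvent_monotone_iter _ _ _).
Qed.

Section Saddle.
Variables (xs : H) (zs ws : 'I_N -> H).
Hypothesis hs : is_saddle xs zs ws.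

Let ee k i := 2 * ip (y k.+1 i - xs) (B i (y k.+1 i) - B i (y k i)).
(** With [D2, D1, D0] the last three squared increments of [z], the Lipschitz error of a step is at
    most [c/4 (D2 + 2 D1 + D0)]. The weights 3 and 1 prepay the delayed shares, so each increment is
    charged [c] in total and [(1 - c) D2] is left. This is the origin of the constant 8. *)
Let vi k i := (alpha i)^-1 * (nsq (z k.+2 i - zs i)
   + c / 4 * (3 * nsq (dz k.+1 i) + nsq (dz k i))) - ee k.+1 i.
Let wh k i := w k i - ws i.

Lemma saddle_monotone k i : 0 <= ip (x k i - xs) ((z k i - x k i) - (zs i - xs)).
Proof.
case: hs => Axs _ _; have := resolvent_monotone k (Axs i).
by rewrite scalerA mulfV ?gt_eqF// scale1r.
Qed.

Lemma lipschitz_term_le i r p q : alpha i * (2 * ip r (B i p - B i q)) <=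
   c / 8 * (nsq r + nsq (p - q)).
Proof.
have := ip_lipschitz_le hip r (L0 i) (lB i p q); rewrite -(ler_pM2l (a0 i)) => h.
apply: le_trans h _; rewrite mulrA ler_wpM2r//.
by rewrite addr_ge0// /nsq ipxx_ge0.
Qed.

Lemma descent_component k i :
  vi k.+1 i + (alpha i)^-1 * ((1 - c) * nsq (dz k.+2 i))
    + 2 * ip (wh k.+2 i) (y k.+3 i - xs) <= vi k i.
Proof.
case: (hs) => Axs zsE ws0.
have ai := a0 i; have a_neq0 : alpha i != 0 by rewrite gt_eqF.
have mBi : 0 <= alpha i * ip (y k.+3 i - xs) (B i (y k.+3 i) - B i xs).
  by apply: mulr_ge0; [exact: ltW|exact: mB].
have := descent_step hip (zE k.+2 i) (yE k.+2 i) (zsE i) (saddle_monotone k.+2 i) mBi.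
have := lipschitz_term_le i (- (y k.+3 i - y k.+2 i)) (y k.+2 i) (y k.+1 i).
have := dy_le k.+1 i; have := dy_le k i.
(* The reflection in [v] splits the error into a telescoping difference of [ee] and a product of
   consecutive increments. *)
have eB : 2 * alpha i * ip (y k.+3 i - xs) (B i (y k.+3 i) - v k.+2 i) =
   alpha i * ee k.+2 i - alpha i * ee k.+1 i
   + alpha i * (2 * ip (- (y k.+3 i - y k.+2 i)) (B i (y k.+2 i) - B i (y k.+1 i))).
  by rewrite vE /ee !ipE; ring.
have nN r : nsq (- r) = nsq r by rewrite /nsq !ipE opprK.
rewrite nN eB /vi.
have := ipxx_ge0 hip (dz k.+2 i).
rewrite -/(nsq (dz k.+2 i)) -/(dz k.+2 i) -/(wh k.+2 i) -/(nsq (dz k.+2 i)).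
rewrite -/(nsq (z k.+3 i - zs i)) -/(nsq (z k.+2 i - zs i)).
move: (nsq (dz k.+2 i)) (nsq (dz k.+1 i)) (nsq (dz k i)) => D2 D1 D0.
move: (nsq (y k.+3 i - _)) (nsq (y k.+2 i - _)) (nsq (z k.+3 i - zs i)) (nsq (z k.+2 i - zs i)).
move: (ip (- _) _) (ip (wh _ _) _) (ee k.+2 i) (ee k.+1 i) => P W e2 e1 Y2 Y1 n3 n2.
move=> hD2 hY1 hY2 hP hd.
have hY : c / 8 * (Y2 + Y1) <= c / 8 * (2 * D2 + 2 * D1 + (2 * D1 + 2 * D0)).
  by apply: ler_wpM2l; [exact: divr_ge0|lra].
have key : n3 + c / 4 * (3 * D2 + D1) - alpha i * e2 + (1 - c) * D2 + 2 * alpha i * W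
   <= n2 + c / 4 * (3 * D1 + D0) - alpha i * e1 by lra.
rewrite -(ler_pM2l ai); apply: (le_trans _ (le_trans key _)).
  by rewrite le_eqVlt; apply/orP; left; apply/eqP; field.
by rewrite le_eqVlt; apply/orP; left; apply/eqP; field.
Qed.

(** The negative term costs at most [c/8 (6 n2 + 6 D1 + 2 D0)], with [n2] the squared distance of
    [z] to [zs]. The increments cancel exactly against the correction, and
    [n2 - 3c/4 n2 >= n2/4]. *)
Lemma lyapunov_component_ge k i : (alpha i)^-1 * (nsq (z k.+2 i - zs i) / 4) <= vi k i.
Proof.
have ai := a0 i; have a_neq0 : alpha i != 0 by rewrite gt_eqF.
have := lipschitz_term_le i (y k.+2 i - xs) (y k.+2 i) (y k.+1 i).
have := dy_le k i.
have := firm_residual_le hip (saddle_monotone k.+1 i).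
have e1 : y k.+2 i - xs = (z k.+2 i - zs i) + ((x k.+1 i - xs) - (z k.+1 i - zs i)).
  by rewrite yE; apply: (ip_ext hip) => h; rewrite !ipE; ring.
have e2 : z k.+1 i - zs i = (z k.+2 i - zs i) - dz k.+1 i.
  by rewrite /dz; apply: (ip_ext hip) => h; rewrite !ipE; ring.
have := nsqD_le hip (z k.+2 i - zs i) ((x k.+1 i - xs) - (z k.+1 i - zs i)).
have := nsqB_le hip (z k.+2 i - zs i) (dz k.+1 i).
rewrite -e1 -e2 /vi -/(ee k.+1 i).
have := ipxx_ge0 hip (z k.+2 i - zs i).
rewrite -/(nsq (z k.+2 i - zs i)) -/(nsq (z k.+1 i - zs i)) -/(nsq (dz k.+1 i)) -/(nsq (y k.+2 i - xs)).
rewrite -/(nsq (x k.+1 i - xs - (z k.+1 i - zs i))).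
move: (nsq (dz k.+1 i)) (nsq (dz k i)) => D1 D0.
move: (nsq (x k.+1 i - xs - _)) (nsq (y k.+2 i - xs)) (nsq (y k.+2 i - y k.+1 i))
  (nsq (z k.+2 i - zs i)) (nsq (z k.+1 i - zs i)) (ee k.+1 i).
move=> f Y dY n2 n1 e n2_ge0 h1 h2 h3 h4 h5.
have hY : c / 8 * (Y + dY) <= c / 8 * (6 * n2 + 6 * D1 + 2 * D0).
  by apply: ler_wpM2l; [exact: divr_ge0|lra].
have hc : 0 <= (1 - c) * n2 by apply: mulr_ge0 => //; rewrite subr_ge0 ltW.
have key : n2 / 4 <= n2 + c / 4 * (3 * D1 + D0) - alpha i * e by lra.
rewrite -(ler_pM2l ai); apply: (le_trans _ (le_trans key _)).
  by rewrite le_eqVlt; apply/orP; left; apply/eqP; field.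
by rewrite le_eqVlt; apply/orP; left; apply/eqP; field.
Qed.

Let V k := \sum_i vi k i + qd (wh k.+1) (wh k.+1).
Let dw k i := w k.+1 i - w k i.

Lemma sum_wh k : \sum_i wh k i = 0.
Proof. by case: (hs) => _ _ ws0; rewrite sumrB sw ws0 subrr. Qed.

Lemma sum_dw k : \sum_i dw k i = 0.
Proof. by rewrite sumrB !sw subrr. Qed.

Lemma lyapunov_step k :
  V k.+1 + \sum_i (alpha i)^-1 * ((1 - c) * nsq (dz k.+2 i)) + qd (dw k.+1) (dw k.+1) <= V k.
Proof.
(* The constant vector [xs] drops out against the zero-sum [wh]; [dual] and the polarization
   identity then produce telescoping [Q]-squares. *)
have dualE : \sum_i 2 * ip (wh k.+2 i) (y k.+3 i - xs) =
    qd (wh k.+2) (wh k.+2) + qd (dw k.+1) (dw k.+1) - qd (wh k.+1) (wh k.+1).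
  rewrite -mulr_sumr (_ : \sum_i _ = prod_ip ip (wh k.+2) (y k.+3)); last first.
    have e0 : \sum_i ip (wh k.+2 i) xs = 0 by rewrite -(ip_suml hip) sum_wh (ip0l hip).
    transitivity (prod_ip ip (wh k.+2) (y k.+3) - \sum_i ip (wh k.+2 i) xs); last by rewrite e0 subr0.
    by rewrite /prod_ip -sumrB; apply: eq_bigr => i _; rewrite ipDr// ipNr.
  rewrite (dual _ (sum_wh _)) -/(qd _ _).
  have whE : wh k.+1 = fun i => wh k.+2 i - dw k.+1 i.
    apply/funext => i; rewrite /wh /dw.
    by apply: (ip_ext hip) => h; rewrite !ipE; ring.
  by rewrite whE; exact: qd_polar.
have : \sum_i (vi k.+1 i + (alpha i)^-1 * ((1 - c) * nsq (dz k.+2 i))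
    + 2 * ip (wh k.+2 i) (y k.+3 i - xs)) <= \sum_i vi k i.
  by apply: ler_sum => i _; exact: descent_component.
rewrite big_split /= big_split /= dualE /V; lra.
Qed.

Lemma sum_lyapunov_ge k : \sum_i (alpha i)^-1 * (nsq (z k.+2 i - zs i) / 4) <= \sum_i vi k i.
Proof. by apply: ler_sum => i _; exact: lyapunov_component_ge. Qed.

Lemma weighted_nsq_ge0 (t : R) (f : 'I_N -> H) i : 0 <= t ->
  0 <= (alpha i)^-1 * (t * nsq (f i)).
Proof.
move=> t0; apply: mulr_ge0; first by rewrite invr_ge0 ltW.
by apply: mulr_ge0 => //; exact: ipxx_ge0.
Qed.

Lemma lyapunov_ge0 k : 0 <= V k.
Proof.
apply: addr_ge0; last exact/pQ/sum_wh.
apply: le_trans (sum_lyapunov_ge k); apply: sumr_ge0 => i _.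
by rewrite [_ / 4]mulrC; apply: (weighted_nsq_ge0 (fun i => z k.+2 i - zs i)); lra.
Qed.

Lemma increment_ge0 k :
  0 <= \sum_i (alpha i)^-1 * ((1 - c) * nsq (dz k.+2 i)) /\ 0 <= qd (dw k.+1) (dw k.+1).
Proof.
split; last exact/pQ/sum_dw.
by apply: sumr_ge0 => i _; apply: weighted_nsq_ge0; rewrite subr_ge0 ltW.
Qed.

Lemma lyapunov_nonincreasing : {homo V : n m / (n <= m)%N >-> m <= n}.
Proof.
move=> n m; elim: m => [|m ih]; first by rewrite leqn0 => /eqP ->.
rewrite leq_eqVlt => /orP[/eqP ->//|]; rewrite ltnS => /ih le.
apply: le_trans le; have := lyapunov_step m; have [] := increment_ge0 m; lra.
Qed.

Lemma lyapunov_cvg : exists l : R, V @ \oo --> l.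
Proof.
have /cvg_ex[l Vl] : cvgn V; last by exists l.
apply: nonincreasing_is_cvgn; first exact: lyapunov_nonincreasing.
by exists 0 => _ [k _ <-]; exact: lyapunov_ge0.
Qed.

Lemma lyapunov_diff_cvg0 : (fun k => V k - V k.+1) @ \oo --> (0 : R).
Proof.
have [l Vl] := lyapunov_cvg.
rewrite -(subrr l); apply: cvgB => //.
by move: Vl; rewrite -cvg_shiftS.
Qed.

Lemma qd_dw_cvg0 : (fun k => qd (dw k.+1) (dw k.+1)) @ \oo --> (0 : R).
Proof.
apply: (@squeeze_cvgr _ _ _ _ (fun=> 0) (fun k => V k - V k.+1)); last first.
- exact: lyapunov_diff_cvg0.
- exact: cvg_cst.
- apply: nearW => k; have := lyapunov_step k; have [h1 h2] := increment_ge0 k => h.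
  by rewrite h2 /=; lra.
Qed.

Lemma dz_cvg0 i : (fun k => `|z k.+1 i - z k i|) @ \oo --> (0 : R).
Proof.
pose t := (alpha i)^-1 * (1 - c).
have t0 : 0 < t by rewrite mulr_gt0 ?invr_gt0 ?subr_gt0.
have h : (fun k => nsq (dz k.+2 i)) @ \oo --> (0 : R).
  apply: (@squeeze_cvgr _ _ _ _ (fun=> 0) (fun k => t^-1 * (V k - V k.+1))).
  - apply: nearW => k; rewrite /nsq ipxx_ge0//= ler_pdivlMl//.
    have := lyapunov_step k; have [_ h2] := increment_ge0 k.
    rewrite (bigD1 i)//= mulrA -/t.
    have : 0 <= \sum_(j < N | j != i) (alpha j)^-1 * ((1 - c) * nsq (dz k.+2 j)).
      by apply: sumr_ge0 => j _; apply: weighted_nsq_ge0; rewrite subr_ge0 ltW.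
    by rewrite -/(nsq _); lra.
  - exact: cvg_cst.
  - by rewrite -(mulr0 t^-1); apply: cvgMl_tmp; exact: lyapunov_diff_cvg0.
rewrite -cvg_shiftS -cvg_shiftS; apply: cvg0_of_sqr.
by under eq_cvg do rewrite -(ipxx hip).
Qed.

Lemma z_bounded i : exists M, forall k, `|z k i - zs i| <= M.
Proof.
(* The Lyapunov function sees [z] only from index 2 on, so the first two iterates are bounded by
   themselves. *)
exists (`|z 0 i - zs i| + `|z 1 i - zs i| + Num.sqrt (4 * alpha i * V 0)) => k.
have s0 : 0 <= Num.sqrt (4 * alpha i * V 0) by exact: sqrtr_ge0.
have n0 := normr_ge0 (z 0 i - zs i); have n1 := normr_ge0 (z 1 i - zs i).
case: k => [|[|k]]; [lra|lra|].
suff : `|z k.+2 i - zs i| <= Num.sqrt (4 * alpha i * V 0) by lra.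
rewrite -[X in X <= _]normr_id -sqrtr_sqr ler_wsqrtr// -(ipxx hip) -/(nsq _).
have ai := a0 i.
have le1 : V k <= V 0 by exact: lyapunov_nonincreasing.
have : (alpha i)^-1 * (nsq (z k.+2 i - zs i) / 4) <= V 0.
  apply: le_trans le1; rewrite /V -[X in X <= _]addr0; apply: lerD; last exact/pQ/sum_wh.
  apply: le_trans (sum_lyapunov_ge k); rewrite (bigD1 i)//= lerDl.
  apply: sumr_ge0 => j _.
  by rewrite [_ / 4]mulrC; apply: (weighted_nsq_ge0 (fun i => z k.+2 i - zs i)); lra.
by rewrite ler_pdivrMl//; lra.
Qed.

Lemma qd_wh_bounded : exists M, forall k, qd (wh k.+1) (wh k.+1) <= M.
Proof.
exists (V 0) => k; apply: le_trans (_ : V k <= _); last exact: lyapunov_nonincreasing.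
rewrite /V lerDr; apply: le_trans (sum_lyapunov_ge k); apply: sumr_ge0 => i _.
by rewrite [_ / 4]mulrC; apply: (weighted_nsq_ge0 (fun i => z k.+2 i - zs i)); lra.
Qed.

Lemma x_bounded i : exists M, forall k, `|x k i - xs| <= M.
Proof.
have [M hM] := z_bounded i; exists (2 * M) => k.
have := firm_residual_le hip (saddle_monotone k i); rewrite !(ipxx hip) ler_sqr ?nnegrE// => le1.
have -> : x k i - xs = (x k i - xs - (z k i - zs i)) + (z k i - zs i) by rewrite subrK.
apply: le_trans (ler_normD _ _) _; have := hM k; lra.
Qed.

Lemma y_bounded i : exists M, forall k, `|y k.+1 i - xs| <= M.
Proof.
have [M hM] := z_bounded i; have [M' hM'] := x_bounded i; exists (M' + 2 * M) => k.
have -> : y k.+1 i - xs = (x k i - xs) + (z k.+1 i - zs i) - (z k i - zs i).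
  by rewrite yE; apply: (ip_ext hip) => h; rewrite !ipE; ring.
apply: le_trans (ler_normB _ _) _; apply: le_trans (lerD (ler_normD _ _) (lexx _)) _.
have := hM k; have := hM k.+1; have := hM' k; lra.
Qed.

Lemma dy_cvg0 i : (fun k => `|y k.+2 i - y k.+1 i|) @ \oo --> (0 : R).
Proof.
apply: (@squeeze_cvgr _ _ _ _ (fun=> 0)
  (fun k => `|z k.+2 i - z k.+1 i| + `|z k.+1 i - z k i|)).
- apply: nearW => k; rewrite normr_ge0 /=.
  have -> : y k.+2 i - y k.+1 i = dz k.+1 i + ((x k.+1 i - x k i) - (z k.+1 i - z k i)).
    by rewrite !yE /dz; apply: (ip_ext hip) => h; rewrite !ipE; ring.
  apply: le_trans (ler_normD _ _) _; rewrite lerD2l.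
  have := firm_residual_le hip (resolvent_monotone_iter k.+1 k i).
  by rewrite !(ipxx hip) ler_sqr ?nnegrE.
- exact: cvg_cst.
- rewrite -[X in _ --> X]addr0; apply: cvgD; last exact: dz_cvg0.
  by have := dz_cvg0 i; rewrite -cvg_shiftS.
Qed.

Lemma ee_cvg0 i : (fun k => ee k.+1 i) @ \oo --> (0 : R).
Proof.
have [M hM] := y_bounded i.
have hb : (fun k => 2 * (M * (L i * `|y k.+2 i - y k.+1 i|))) @ \oo --> (0 : R).
  rewrite (_ : 0 = 2 * (M * (L i * 0)) :> R); last by rewrite !mulr0.
  do 3! apply: cvgMl_tmp.
  exact: dy_cvg0.
have hn k : `|ee k.+1 i| <= 2 * (M * (L i * `|y k.+2 i - y k.+1 i|)).
  rewrite /ee normrM ger0_norm// ler_pM2l//.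
  apply: le_trans (normr_ip hip _ _) _.
  by apply: ler_pM => //; exact: lB.
apply/norm_cvg0P; apply: (@squeeze_cvgr _ _ _ _ (fun=> 0) _ _ _ _ _ hb); last exact: cvg_cst.
by apply: nearW => k; rewrite normr_ge0 hn.
Qed.

(** Opial's argument needs the pure squared distances; all correction terms in [V] tend to zero and
    can be removed. *)
Lemma fejer_cvg : exists l : R,
  (fun k => \sum_i (alpha i)^-1 * nsq (z k.+2 i - zs i) + qd (wh k.+1) (wh k.+1)) @ \oo --> l.
Proof.
have [l Vl] := lyapunov_cvg; exists l.
pose r i k := (alpha i)^-1 * (c / 4 * (3 * nsq (dz k.+1 i) + nsq (dz k i))) - ee k.+1 i.
have -> : (fun k => \sum_i (alpha i)^-1 * nsq (z k.+2 i - zs i) + qd (wh k.+1) (wh k.+1))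
   = (fun k => V k - \sum_i r i k).
  apply/funext => k; rewrite /V addrAC -sumrB; congr (_ + _); apply: eq_bigr => i _.
  by rewrite /vi /r; ring.
have dzsq i : (fun k => nsq (dz k i)) @ \oo --> (0 : R).
  rewrite (_ : (fun k => _) = (fun k => `|dz k i| * `|dz k i|)); last first.
    by apply/funext => k; rewrite /nsq (ipxx hip) expr2.
  by rewrite -(mulr0 0); apply: cvgM; exact: dz_cvg0.
rewrite -[X in _ --> X]subr0; apply: cvgB => //.
suff : (fun k => \sum_i r i k) @ \oo --> \sum_(i < N) (0 : R) by rewrite big1.
apply: cvg_sum_ord => i.
rewrite (_ : 0 = (alpha i)^-1 * (c / 4 * (3 * 0 + 0)) - 0 :> R); last by rewrite !(mulr0, addr0, subr0).
apply: cvgB; last exact: ee_cvg0.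
do 2! apply: cvgMl_tmp; apply: cvgD => //; apply: cvgMl_tmp.
by have := dzsq i; rewrite -cvg_shiftS.
Qed.

End Saddle.

(** * Weak cluster points of the iterates *)

Section Cluster.
Variables (xs0 : H) (zs0 ws0 : 'I_N -> H).
Hypothesis hs0 : is_saddle xs0 zs0 ws0.
Hypothesis N0 : (0 < N)%N.

Lemma bounded_of_centered (u : nat -> H) p : (exists M, forall k, `|u k - p| <= M) ->
  exists M, forall k, `|u k| <= M.
Proof.
move=> [M hM]; exists (M + `|p|) => k; rewrite -[u k](subrK p).
by apply: le_trans (ler_normD _ _) _; rewrite lerD2r.
Qed.

Lemma z_norm_bounded i : exists M, forall k, `|z k i| <= M.
Proof. exact/bounded_of_centered/(z_bounded hs0). Qed.

Lemma x_norm_bounded i : exists M, forall k, `|x k i| <= M.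
Proof. exact/bounded_of_centered/(x_bounded hs0). Qed.

Lemma y_norm_bounded i : exists M, forall k, `|y k.+1 i| <= M.
Proof. exact: (bounded_of_centered (y_bounded hs0 i)). Qed.

Lemma By_norm_bounded i : exists M, forall k, `|B i (y k.+1 i)| <= M.
Proof.
have [M hM] := y_bounded hs0 i.
apply: (@bounded_of_centered _ (B i xs0)); exists (L i * M) => k.
by apply: le_trans (lB _ _ _) _; rewrite ler_pM2l.
Qed.

Lemma wE k i : w k i = (alpha i)^-1 *: (x k i - z k.+1 i) - v k i.
Proof.
by apply: (ip_ext hip) => h; rewrite zE !ipE; field; rewrite gt_eqF.
Qed.

Lemma inva_ge0 i : 0 <= (alpha i)^-1.
Proof. by rewrite invr_ge0 ltW. Qed.

(** [V] controls [w] only in the seminorm of [Q]; the norm bound comes from solving the update of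
    [z] for [w]. *)
Lemma w_norm_bounded i : exists M, forall k, `|w k.+2 i| <= M.
Proof.
have [Mz hz] := z_norm_bounded i; have [Mx hx] := x_norm_bounded i.
have [Mb hb] := By_norm_bounded i.
exists ((alpha i)^-1 * (Mx + Mz) + (2 * Mb + Mb)) => k.
rewrite wE vE; apply: le_trans (ler_normB _ _) _; apply: lerD.
  rewrite normrZ ger0_norm ?inva_ge0// ler_wpM2l ?inva_ge0//.
  by apply: le_trans (ler_normB _ _) _; apply: lerD.
apply: le_trans (ler_normB _ _) _; apply: lerD => //.
by rewrite normrZ ger0_norm// ler_wpM2l.
Qed.

Let dw k i := w k.+1 i - w k i.

Lemma qd_cvg0 (f : nat -> 'I_N -> H) (M : R) :
  (forall k, \sum_i f k i = 0) -> (forall k, qd (f k) (f k) <= M) ->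
  (fun k => qd (f k) (dw k.+1)) @ \oo --> (0 : R).
Proof.
move=> f0 fM; apply: cvg0_of_sqr.
apply: (@squeeze_cvgr _ _ _ _ (fun=> 0) (fun k => M * qd (dw k.+1) (dw k.+1))).
- apply: nearW => k; rewrite sqr_ge0 /=.
  apply: le_trans (qd_cauchy_schwarz (f0 k) (sum_dw k.+1)) _.
  by rewrite ler_wpM2r//; exact/pQ/sum_dw.
- exact: cvg_cst.
- by rewrite -(mulr0 M); apply: cvgMl_tmp; exact: (qd_dw_cvg0 hs0).
Qed.

(** This is the one pairing of two merely weakly convergent sequences. [dual] turns it into a
    [Q]-product with the increment of [w], which vanishes in seminorm. *)
Lemma prod_ip_wy_cvg0 : (fun k => prod_ip ip (w k.+2) (y k.+3)) @ \oo --> (0 : R).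
Proof.
have [M hM] := qd_wh_bounded hs0; case: (hs0) => _ _ sws0.
have -> : (fun k => prod_ip ip (w k.+2) (y k.+3)) =
    (fun k => qd (fun i => w k.+2 i - ws0 i) (dw k.+1) + qd ws0 (dw k.+1)).
  by apply/funext => k; rewrite dual ?sw// qdBl subrK.
rewrite -[X in _ --> X]addr0; apply: cvgD.
  by apply: (@qd_cvg0 _ M) => k; [exact: (sum_wh hs0)|exact: hM].
exact: (@qd_cvg0 (fun=> ws0) (qd ws0 ws0)).
Qed.

(** The iterates satisfy the saddle equation up to an error that vanishes in norm: the increments of
    [z] and [y] account for all of it. *)
Lemma residual_cvg0 i : (fun k => `|B i (y k.+3 i) + w k.+2 i
    + (alpha i)^-1 *: (z k.+2 i - x k.+2 i)|) @ \oo --> (0 : R).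
Proof.
have dz2 := dz_cvg0 hs0 i; rewrite -cvg_shiftS -cvg_shiftS /= in dz2.
have dy1 := dy_cvg0 hs0 i; have dy2 := dy1; rewrite -cvg_shiftS /= in dy2.
apply: (@squeeze_cvgr _ _ _ _ (fun=> 0) (fun k => L i * `|y k.+3 i - y k.+2 i|
   + L i * `|y k.+2 i - y k.+1 i| + (alpha i)^-1 * `|z k.+3 i - z k.+2 i|)).
- apply: nearW => k; rewrite normr_ge0 /=.
  have -> : B i (y k.+3 i) + w k.+2 i + (alpha i)^-1 *: (z k.+2 i - x k.+2 i) =
      (B i (y k.+3 i) - B i (y k.+2 i)) - (B i (y k.+2 i) - B i (y k.+1 i))
      - (alpha i)^-1 *: (z k.+3 i - z k.+2 i).
    by rewrite wE vE; apply: (ip_ext hip) => h; rewrite !ipE; ring.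
  apply: le_trans (ler_normB _ _) _; apply: lerD.
    apply: le_trans (ler_normB _ _) _; apply: lerD; exact: lB.
  by rewrite normrZ ger0_norm ?inva_ge0.
- exact: cvg_cst.
- rewrite (_ : 0 = L i * 0 + L i * 0 + (alpha i)^-1 * 0 :> R); last by rewrite !mulr0 !addr0.
  by apply: cvgD; [apply: cvgD|]; apply: cvgMl_tmp.
Qed.

Lemma weak_z_succ (F : set_system nat) (FF : Filter F) (l : H) i h : \oo `<=` F ->
  (fun k => ip (z k.+2 i) h) @ F --> ip l h -> (fun k => ip (z k.+3 i) h) @ F --> ip l h.
Proof.
move=> hF zl.
have dz2 := dz_cvg0 hs0 i; rewrite -cvg_shiftS -cvg_shiftS /= in dz2.
have -> : (fun k => ip (z k.+3 i) h) =
    (fun k => ip (z k.+2 i) h + ip h (z k.+3 i - z k.+2 i)).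
  by apply/funext => k; rewrite (ipC hip h) !ipE addrC subrK.
rewrite -[X in _ --> X]addr0; apply: cvgD => //.
apply: (@ip_cvg0 _ _ _ _ F _ (fun=> h) (fun k => z k.+3 i - z k.+2 i) `|h| hip) => //.
by move=> V /dz2; exact: hF.
Qed.

Lemma weak_y (F : set_system nat) (FF : Filter F) (l : H) i h : \oo `<=` F ->
  (fun k => ip (x k.+2 i) h) @ F --> ip l h -> (fun k => ip (y k.+3 i) h) @ F --> ip l h.
Proof.
move=> hF zl.
have dz2 := dz_cvg0 hs0 i; rewrite -cvg_shiftS -cvg_shiftS /= in dz2.
have -> : (fun k => ip (y k.+3 i) h) =
    (fun k => ip (x k.+2 i) h + ip h (z k.+3 i - z k.+2 i)).
  by apply/funext => k; rewrite (ipC hip h) yE !ipE addrA.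
rewrite -[X in _ --> X]addr0; apply: cvgD => //.
apply: (@ip_cvg0 _ _ _ _ F _ (fun=> h) (fun k => z k.+3 i - z k.+2 i) `|h| hip) => //.
by move=> V /dz2; exact: hF.
Qed.

Section Ultra.
Variables (U : set_system nat).
Hypothesis UU : UltraFilter U.
Hypothesis hU : \oo `<=` U.
Variables (zl wl xl : 'I_N -> H).
Hypothesis zlE : forall i h, (fun k => ip (z k.+2 i) h) @ U --> ip (zl i) h.
Hypothesis wlE : forall i h, (fun k => ip (w k.+2 i) h) @ U --> ip (wl i) h.
Hypothesis xlE : forall i h, (fun k => ip (x k.+2 i) h) @ U --> ip (xl i) h.

Lemma cvg_ultra (f : nat -> R) (l : R) : f @ \oo --> l -> f @ U --> l.
Proof. by move=> fl V /fl; exact: hU. Qed.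

Lemma sum_wl : \sum_i wl i = 0.
Proof.
apply: (ip_ext hip) => h; rewrite (ip_suml hip) (ip0l hip).
have : (fun k => \sum_i ip (w k.+2 i) h) @ U --> \sum_i ip (wl i) h.
  by apply: cvg_sum_ord => i; exact: wlE.
have -> : (fun k => \sum_i ip (w k.+2 i) h) = fun=> 0.
  by apply/funext => k; rewrite -(ip_suml hip) sw (ip0l hip).
by move=> l0; exact: (cvg_real_unique l0 (cvg_cst _)).
Qed.

(** The deviation [h] of [xl] from its mean has zero sum, so [<h, y>] is a [Q]-product with the
    increment of [w] and tends to zero. In the limit [<h, xl> = 0], that is [|h|^2 = 0]. *)
Lemma consensus : exists m, forall i, xl i = m.
Proof.
pose m := N%:R^-1 *: \sum_i xl i; exists m => i.
pose h i := xl i - m.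
have h0 : \sum_i h i = 0.
  rewrite sumrB sumr_const card_ord -scaler_nat scalerA mulfV ?scale1r ?subrr//.
  by rewrite pnatr_eq0 -lt0n.
have e0 : \sum_i ip (xl i) (h i) = 0.
  have : (fun k => \sum_i ip (y k.+3 i) (h i)) @ U --> \sum_i ip (xl i) (h i).
    by apply: cvg_sum_ord => j; apply: weak_y => //; exact: xlE.
  have := cvg_ultra (@qd_cvg0 (fun=> h) (qd h h) (fun=> h0) (fun=> lexx _)).
  have -> : (fun k => qd h (dw k.+1)) = (fun k => \sum_i ip (y k.+3 i) (h i)).
    apply/funext => k; rewrite -[LHS]dual//; apply: eq_bigr => j _; exact: ipC.
  by move=> l1 l2; exact: (cvg_real_unique l2 l1).
have e1 : \sum_i ip (h i) (h i) = 0.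
  transitivity (\sum_i ip (xl i) (h i) - ip m (\sum_i h i)).
    rewrite (ip_sumr hip) -sumrB; apply: eq_bigr => j _.
    by rewrite {1}/h (ipDl hip) (ipNl hip).
  by rewrite e0 h0 (ip0r hip) subr0.
apply/eqP; rewrite -subr_eq0; apply/eqP/(ipxx_eq0 hip)/eqP.
move/eqP: e1; rewrite psumr_eq0 => [/allP/(_ i (mem_index_enum i))//|j _].
exact: ipxx_ge0.
Qed.

Variable m : H.
Hypothesis xlm : forall i, xl i = m.
Let al i := (alpha i)^-1 *: (zl i - m).
Let bl i := - al i - wl i.

Lemma limit_monotone (p q r : 'I_N -> H) : (forall i, A i (p i) (q i)) ->
  0 <= \sum_i (ip (m - p i) (al i - q i) + ip (m - r i) (bl i - B i (r i))).
Proof.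
move=> Apq.
pose a k i := (alpha i)^-1 *: (z k.+2 i - x k.+2 i).
pose eps k i := B i (y k.+3 i) + w k.+2 i + a k i.
pose inc k i := z k.+3 i - z k.+2 i.
pose S k := \sum_i (ip (x k.+2 i - p i) (a k i - q i)
                    + ip (y k.+3 i - r i) (B i (y k.+3 i) - B i (r i))).
(* The monotonicity sum splits into [-<w, y>], the error [Er] that vanishes because of a norm-null
   factor, and [T], which is affine in the iterates and so passes to weak limits. *)
pose Er k i := ip (y k.+3 i) (eps k i) - ip (a k i) (inc k i) - ip (r i) (eps k i).
pose T (X W Al Y : H) i := ip (p i) (q i) + ip (r i) (B i (r i))
  - ip X (q i) - ip Al (p i) - ip Y (B i (r i)) + ip W (r i) + ip Al (r i).
have S_ge0 k : 0 <= S k.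
  apply: sumr_ge0 => i _; apply: addr_ge0; last exact: mB.
  have := resolventP hip (z k.+2 i) (mA i) (a0 i); rewrite -xE => Ax.
  exact: (mA i).1.
have SE k : S k = (- prod_ip ip (w k.+2) (y k.+3) + \sum_i Er k i)
    + \sum_i T (x k.+2 i) (w k.+2 i) (a k i) (y k.+3 i) i.
  rewrite /S /prod_ip -sumrN -!big_split /=; apply: eq_bigr => i _.
  have -> : B i (y k.+3 i) = eps k i - w k.+2 i - a k i.
    by apply: (ip_ext hip) => h; rewrite /eps !ipE; ring.
  have -> : x k.+2 i = y k.+3 i - inc k i.
    by apply: (ip_ext hip) => h; rewrite yE /inc !ipE; ring.
  rewrite /T /Er; move: (eps k i) (a k i) (inc k i) => e ak d.
  rewrite !ipE (ipC hip _ (w k.+2 i)) (ipC hip d ak) (ipC hip (y k.+3 i) ak).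
  by rewrite (ipC hip (p i) ak) (ipC hip (r i) ak) (ipC hip (r i) (w k.+2 i)); ring.
have incc i : (fun k => `|inc k i|) @ U --> (0 : R).
  by apply: cvg_ultra; have := dz_cvg0 hs0 i; rewrite -cvg_shiftS -cvg_shiftS.
have epsc i : (fun k => `|eps k i|) @ U --> (0 : R) by exact/cvg_ultra/residual_cvg0.
have Ec i : (fun k => Er k i) @ U --> (0 : R).
  have [My hy] := y_norm_bounded i; have [Mz hz] := z_norm_bounded i.
  have [Mx hx] := x_norm_bounded i.
  rewrite -[X in _ --> X](subrr 0) -{1}(subrr (0 : R)); apply: cvgB; first apply: cvgB.
  - by apply: (@ip_cvg0 _ _ _ _ U _ (fun k => y k.+3 i) (fun k => eps k i) My hip).
  - apply: (@ip_cvg0 _ _ _ _ U _ (a^~ i) (inc^~ i) ((alpha i)^-1 * (Mz + Mx)) hip) => // k.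
    rewrite /a.
    rewrite normrZ ger0_norm ?inva_ge0// ler_wpM2l ?inva_ge0//.
    by apply: le_trans (ler_normB _ _) _; apply: lerD.
  - exact: (@ip_cvg0 _ _ _ _ U _ (fun=> r i) (fun k => eps k i) `|r i| hip).
have ac i h : (fun k => ip (a k i) h) @ U --> ip (al i) h.
  have -> : (fun k => ip (a k i) h) =
      (fun k => (alpha i)^-1 * (ip (z k.+2 i) h - ip (x k.+2 i) h)).
    by apply/funext => k; rewrite /a !ipE.
  rewrite /al !ipE; apply: cvgMl_tmp; apply: cvgB; first exact: zlE.
  by rewrite -(xlm i); exact: xlE.
have Tc i : (fun k => T (x k.+2 i) (w k.+2 i) (a k i) (y k.+3 i) i) @ U -->
    T m (wl i) (al i) m i.
  have xc h : (fun k => ip (x k.+2 i) h) @ U --> ip m h by rewrite -(xlm i).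
  have yc h : (fun k => ip (y k.+3 i) h) @ U --> ip m h by exact: weak_y.
  apply: cvgD; last exact: ac.
  apply: cvgD; last exact: wlE.
  apply: cvgB; last exact: yc.
  apply: cvgB; last exact: ac.
  apply: cvgB; last exact: xc.
  exact: cvg_cst.
have -> : \sum_i (ip (m - p i) (al i - q i) + ip (m - r i) (bl i - B i (r i)))
    = \sum_i T m (wl i) (al i) m i.
  transitivity (\sum_i (T m (wl i) (al i) m i - ip m (wl i))).
    apply: eq_bigr => i _; rewrite /T /bl; move: (al i) => ai; rewrite !ipE.
    rewrite (ipC hip (p i) ai) (ipC hip (r i) ai) (ipC hip (r i) (wl i)); ring.
  by rewrite sumrB -(ip_sumr hip) sum_wl (ip0r hip) subr0.
have Sc : S @ U --> (- 0 + \sum_(i < N) (0 : R)) + \sum_i T m (wl i) (al i) m i.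
  rewrite (_ : S = fun k => (- prod_ip ip (w k.+2) (y k.+3) + \sum_i Er k i)
    + \sum_i T (x k.+2 i) (w k.+2 i) (a k i) (y k.+3 i) i); last exact/funext.
  apply: cvgD; last exact: cvg_sum_ord.
  apply: cvgD; last exact: cvg_sum_ord.
  by apply: cvgN; exact/cvg_ultra/prod_ip_wy_cvg0.
have UF : ProperFilter U by exact: _.
by have := cvg_ge0 UF S_ge0 Sc; rewrite oppr0 add0r [X in 0 <= X + _]big1// add0r.
Qed.

Lemma limit_A i : A i m (al i).
Proof.
(* As only the summed inequality is at hand, Minty's theorem supplies test pairs with
   [p_j + q_j = m + al_j] for all [j] at once. With [r = m] the sum becomes [- \sum_j |m - p_j|^2],
   so every [p_j] equals [m]. *)
have ex j : exists pq : H * H, A j pq.1 pq.2 /\ m + al j = pq.1 + 1 *: pq.2.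
  by have [p [q h]] := minty hip (m + al j) (mA j) ltr01; exists (p, q).
have [pq hpq] := choice ex.
have qE j : al j - (pq j).2 = - (m - (pq j).1).
  have [_] := hpq j; rewrite scale1r => /eqP; rewrite addrC -subr_eq => /eqP e.
  by rewrite opprB -e; apply: (ip_ext hip) => h; rewrite !ipE; ring.
have := @limit_monotone (fun j => (pq j).1) (fun j => (pq j).2) (fun=> m) (fun j => (hpq j).1).
under eq_bigr do rewrite subrr (ip0l hip) addr0 qE (ipNr hip).
rewrite sumrN oppr_ge0 => le0.
have /eqP : \sum_j ip (m - (pq j).1) (m - (pq j).1) = 0.
  by apply/eqP; rewrite eq_le le0; apply: sumr_ge0 => j _; exact: ipxx_ge0.
rewrite psumr_eq0 => [/allP/(_ i (mem_index_enum i))/eqP/(ipxx_eq0 hip) mp|j _]; last exact: ipxx_ge0.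
have := qE i; rewrite mp oppr0 => /eqP; rewrite subr_eq0 => /eqP ->.
by move/eqP: mp; rewrite subr_eq0 => /eqP ->; exact: (hpq i).1.
Qed.

Lemma limit_B i : bl i = B i m.
Proof.
pose h j := bl j - B j m.
(* Moving from [m] along [h] by this step changes [B] by at most [|h|/2], so the test at [m + t h]
   yields at most [- t/2 |h|^2]. *)
pose t j := (2 * L j)^-1.
have t0 j : 0 < t j by rewrite invr_gt0 mulr_gt0.
have := @limit_monotone (fun=> m) al (fun j => m + t j *: h j) limit_A.
have le j : ip (m - m) (al j - al j) + ip (m - (m + t j *: h j)) (bl j - B j (m + t j *: h j))
    <= - (t j / 2 * ip (h j) (h j)).
  rewrite subrr (ip0l hip) add0r opprD addrA subrr add0r.
  have -> : bl j - B j (m + t j *: h j) = h j - (B j (m + t j *: h j) - B j m).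
    by apply: (ip_ext hip) => g; rewrite /h !ipE; ring.
  set d := _ - B j m.
  have hd : ip (h j) d <= 2^-1 * ip (h j) (h j).
    apply: le_trans (ler_norm _) _; apply: le_trans (normr_ip hip _ _) _.
    rewrite (ipxx hip) expr2 mulrCA ler_wpM2l//.
    apply: le_trans (lB _ _ _) _; rewrite addrAC subrr add0r normrZ gtr0_norm// mulrA ler_wpM2r//.
    by rewrite /t le_eqVlt; apply/orP; left; apply/eqP; field; rewrite gt_eqF.
  rewrite (ipNl hip) (ipZl hip) (ipDr hip) (ipNr hip) lerN2 -mulrA ler_pM2l//; lra.
move=> ge0.
have /eqP : \sum_j t j / 2 * ip (h j) (h j) = 0.
  apply/eqP; rewrite eq_le; apply/andP; split.
    rewrite -oppr_ge0 -sumrN; apply: le_trans ge0 _.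
    by apply: ler_sum => j _; exact: le.
  by apply: sumr_ge0 => j _; rewrite mulr_ge0 ?ipxx_ge0// divr_ge0// ltW.
rewrite psumr_eq0 => [/allP/(_ i (mem_index_enum i))|j _]; last first.
  by rewrite mulr_ge0 ?ipxx_ge0// divr_ge0// ltW.
rewrite /= mulf_eq0 gt_eqF ?divr_gt0//= => /eqP/(ipxx_eq0 hip)/eqP.
by rewrite subr_eq0 => /eqP.
Qed.

Lemma limit_saddle : is_saddle m zl wl.
Proof.
split; [exact: limit_A| |exact: sum_wl] => i.
rewrite -limit_B /bl subrK scalerN opprK /al scalerA mulfV ?gt_eqF// scale1r.
by rewrite addrC subrK.
Qed.

End Ultra.

Lemma cluster_saddle (U : set_system nat) : UltraFilter U -> \oo `<=` U ->
  exists xs zs ws, is_saddle xs zs ws /\ forall i h,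
    [/\ (fun k => ip (z k.+2 i) h) @ U --> ip (zs i) h,
        (fun k => ip (w k.+2 i) h) @ U --> ip (ws i) h
      & (fun k => ip (x k.+2 i) h) @ U --> ip xs h].
Proof.
move=> UU hU.
have ex i : exists p : H * H * H, forall h,
    [/\ (fun k => ip (z k.+2 i) h) @ U --> ip p.1.1 h,
        (fun k => ip (w k.+2 i) h) @ U --> ip p.1.2 h
      & (fun k => ip (x k.+2 i) h) @ U --> ip p.2 h].
  have [Mz hz] := z_norm_bounded i; have [Mw hw] := w_norm_bounded i.
  have [Mx hx] := x_norm_bounded i.
  have [zl zlE] := weak_ultra_cvg hip UU (fun k => hz k.+2).
  have [wl wlE] := weak_ultra_cvg hip UU hw.
  have [xl xlE] := weak_ultra_cvg hip UU (fun k => hx k.+2).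
  by exists (zl, wl, xl) => h.
have [p hp] := choice ex.
have zlE i h : (fun k => ip (z k.+2 i) h) @ U --> ip (p i).1.1 h by case: (hp i h).
have wlE i h : (fun k => ip (w k.+2 i) h) @ U --> ip (p i).1.2 h by case: (hp i h).
have xlE i h : (fun k => ip (x k.+2 i) h) @ U --> ip (p i).2 h by case: (hp i h).
have [m hm] := consensus UU hU xlE.
exists m, (fun i => (p i).1.1), (fun i => (p i).1.2); split.
  exact: (limit_saddle UU hU zlE wlE xlE hm).
by move=> i h; split => //; rewrite -(hm i).
Qed.

(* Opial's argument: the difference of the two Fejer functions is affine in the
   iterates, so its limit can be evaluated along either ultrafilter. *)
Lemma cluster_unique (U1 U2 : set_system nat) xs1 zs1 ws1 xs2 zs2 ws2 :
  UltraFilter U1 -> \oo `<=` U1 -> UltraFilter U2 -> \oo `<=` U2 ->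
  is_saddle xs1 zs1 ws1 -> is_saddle xs2 zs2 ws2 ->
  (forall i h, (fun k => ip (z k.+2 i) h) @ U1 --> ip (zs1 i) h) ->
  (forall i h, (fun k => ip (w k.+2 i) h) @ U1 --> ip (ws1 i) h) ->
  (forall i h, (fun k => ip (z k.+2 i) h) @ U2 --> ip (zs2 i) h) ->
  (forall i h, (fun k => ip (w k.+2 i) h) @ U2 --> ip (ws2 i) h) ->
  zs1 = zs2.
Proof.
move=> UU1 hU1 UU2 hU2 hs1 hs2 z1 w1 z2 w2.
pose g (zz ww : 'I_N -> H) := \sum_i (alpha i)^-1 *
    (nsq (zs1 i) - nsq (zs2 i) - 2 * ip (zz i) (zs1 i - zs2 i))
  + (qd ws1 ws1 - qd ws2 ws2 - 2 * qd ww ws1 + 2 * qd ww ws2).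
have [l gl] : exists l : R, (fun k => g (z k.+3) (w k.+2)) @ \oo --> l.
  have [l1 h1] := fejer_cvg hs1; have [l2 h2] := fejer_cvg hs2.
  exists (l1 - l2).
  (* The Fejer function pairs [z^{k+2}] with [w^{k+1}]; one shift reaches [w^{k+2}], whose weak
     limits are known. *)
  rewrite -cvg_shiftS /= in h1; rewrite -cvg_shiftS /= in h2.
  rewrite (_ : (fun k => _) = (fun k =>
      (\sum_i (alpha i)^-1 * nsq (z k.+3 i - zs1 i)
        + qd (fun i => w k.+2 i - ws1 i) (fun i => w k.+2 i - ws1 i))
    - (\sum_i (alpha i)^-1 * nsq (z k.+3 i - zs2 i)
        + qd (fun i => w k.+2 i - ws2 i) (fun i => w k.+2 i - ws2 i)))).
    exact: cvgB.
  apply/funext => k; rewrite /g opprD addrACA; congr (_ + _).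
    rewrite -sumrB; apply: eq_bigr => i _; rewrite /nsq !ipE.
    rewrite (ipC hip (zs1 i) (z _ i)) (ipC hip (zs2 i) (z _ i)).
    ring.
  rewrite !qdBl !qdBr (qdC ws1 (w _)) (qdC ws2 (w _)); ring.
have gU (U : set_system nat) zs ws : UltraFilter U -> \oo `<=` U ->
    (forall i h, (fun k => ip (z k.+2 i) h) @ U --> ip (zs i) h) ->
    (forall i h, (fun k => ip (w k.+2 i) h) @ U --> ip (ws i) h) -> l = g zs ws.
  move=> UU hU zc wc.
  have glU : (fun k => g (z k.+3) (w k.+2)) @ U --> l by move=> V /gl; exact: hU.
  apply: (cvg_real_unique glU).
  have qc h : (fun k => qd (w k.+2) h) @ U --> qd ws h.
    by apply: cvg_sum_ord => i; exact: wc.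
  apply: cvgD.
    apply: cvg_sum_ord => i; apply: cvgMl_tmp; apply: cvgB; first exact: cvg_cst.
    by apply: cvgMl_tmp; exact: weak_z_succ.
  apply: cvgD; last by apply: cvgMl_tmp; exact: qc.
  apply: cvgB; last by apply: cvgMl_tmp; exact: qc.
  exact: cvg_cst.
have e1 := gU U1 _ _ UU1 hU1 z1 w1; have e2 := gU U2 _ _ UU2 hU2 z2 w2.
pose d i := zs1 i - zs2 i.
pose wd i := ws1 i - ws2 i.
(* The two evaluations of the limit differ by twice a squared distance, which must vanish. As [qd]
   is only a seminorm, this separates the [z] components alone. *)
have eq : g zs2 ws2 - g zs1 ws1 = 2 * (\sum_i (alpha i)^-1 * nsq (d i) + qd wd wd).
  rewrite /g opprD addrACA mulrDr; congr (_ + _).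
    rewrite -sumrB mulr_sumr; apply: eq_bigr => i _; rewrite /nsq /d !ipE (ipC hip (zs2 i) (zs1 i)); ring.
  by rewrite /wd qdBl !qdBr (qdC ws2 ws1); ring.
rewrite -e1 -e2 subrr in eq.
have sd_ge0 i : 0 <= (alpha i)^-1 * nsq (d i).
  by apply: mulr_ge0; [exact: inva_ge0|exact: ipxx_ge0].
have q_ge0 : 0 <= qd wd wd.
  apply: pQ; case: hs1 => _ _ s1; case: hs2 => _ _ s2.
  by rewrite sumrB s1 s2 subrr.
have s_ge0 : 0 <= \sum_i (alpha i)^-1 * nsq (d i) by exact: sumr_ge0.
have /eqP : \sum_i (alpha i)^-1 * nsq (d i) = 0 by lra.
rewrite psumr_eq0// => /allP h; apply/funext => i.
have /= := h i (mem_index_enum i); rewrite mulf_eq0 invr_eq0 gt_eqF//= => /eqP/(ipxx_eq0 hip)/eqP.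
by rewrite subr_eq0 => /eqP.
Qed.

Lemma saddle_resolvent xs zs ws i : is_saddle xs zs ws -> resolvent (alpha i) (A i) (zs i) = xs.
Proof.
move=> [Axs _ _]; have := resolvent_eq hip (mA i) (a0 i) (Axs i).
by rewrite scalerA mulfV ?gt_eqF// scale1r addrC subrK.
Qed.

Lemma iteration_weak_cvg : exists xs zs ws, is_saddle xs zs ws /\ forall i h,
    [/\ (fun k => ip (z k i) h) @ \oo --> ip (zs i) h,
        (fun k => ip (x k i) h) @ \oo --> ip xs h
      & (fun k => ip (y k i) h) @ \oo --> ip xs h].
Proof.
have [U [UU hU]] := @ultraFilterLemma _ \oo _.
have [xs [zs [ws [hs hc]]]] := cluster_saddle UU hU.
exists xs, zs, ws; split => // i h.
have allU (U' : set_system nat) : UltraFilter U' -> \oo `<=` U' ->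
    (fun k => ip (z k.+2 i) h) @ U' --> ip (zs i) h /\
    (fun k => ip (x k.+2 i) h) @ U' --> ip xs h.
  move=> UU' hU'; have [xs' [zs' [ws' [hs' hc']]]] := cluster_saddle UU' hU'.
  have zz : zs' = zs.
    apply: (cluster_unique UU' hU' UU hU hs' hs) => j g.
    - by have [] := hc' j g.
    - by have [] := hc' j g.
    - by have [] := hc j g.
    - by have [] := hc j g.
  (* Uniqueness of [xs] is inherited from [zs] because [xs] is its resolvent. *)
  have xx : xs' = xs.
    by rewrite -(saddle_resolvent i hs) -(saddle_resolvent i hs') zz.
  by have [] := hc' i h; rewrite zz xx.
have xc : (fun k => ip (x k.+2 i) h) @ \oo --> ip xs h.
  by apply: cvg_ultraP => U' UU' hU'; have [] := allU U' UU' hU'.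
split.
- rewrite -cvg_shiftS -cvg_shiftS.
  by apply: cvg_ultraP => U' UU' hU'; have [] := allU U' UU' hU'.
- by rewrite -cvg_shiftS -cvg_shiftS.
- by rewrite -cvg_shiftS -cvg_shiftS -cvg_shiftS; exact: weak_y.
Qed.

End Cluster.
End Iteration.

(** * From the stated scheme to the primal-dual form *)

Lemma uniform_ratio (R : realType) (N : nat) (f : 'I_N -> R) :
  (forall i, f i < 1) -> exists c, [/\ 0 <= c, c < 1 & forall i, f i <= c].
Proof.
move=> f1; exists (\big[Num.max/0]_i f i); split.
- exact: bigmax_ge_id.
- by apply: bigmax_lt.
- by move=> i; exact: le_bigmax.
Qed.

Unset Implicit Arguments.

Theorem theorem3p4 (R : realType) (H : completeNormedModType R)
  (ip : H -> H -> R) (N : nat)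
  (A : 'I_N -> H -> set H) (B : 'I_N -> H -> H) (L : 'I_N -> R)
  (E : rel 'I_N) (W : 'M[R]_N) (alpha : 'I_N -> R) (beta : R)
  (x y z v : nat -> 'I_N -> H) :
  is_inner_product ip ->
  (0 < N)%N ->
  (forall i, maximally_monotone ip (A i)) ->
  (forall i, 0 < L i) ->
  (forall i, monotone_fun ip (B i)) ->
  (forall i, lipschitz_with (L i) (B i)) ->
  (exists x0 : H, is_zero_of_sum A B x0) ->
  connected_graph E ->
  mixing_matrix E W ->
  (forall i, 0 < alpha i /\ alpha i < (8 * L i)^-1) ->
  let Lam := diag_mx (\row_i alpha i) in
  let Lamh := diag_mx (\row_i Num.sqrt (alpha i)) in
  0 < beta ->
  beta * mx_opnorm (Lamh *m ((2^-1) *: (1%:M - W)) *m Lamh) < 1 ->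
  let Wt := 1%:M - (beta / 2) *: (Lam *m (1%:M - W)) in
  let J := resolventN alpha A in
  v 0%N = opB B (y 0%N) ->
  x 0%N = J (z 0%N) ->
  y 1%N = (fun i => 2 *: x 0%N i - z 0%N i - mxact Lam (v 0%N) i) ->
  z 1%N = (fun i => y 1%N i + z 0%N i - x 0%N i) ->
  x 1%N = J (z 1%N) ->
  (forall k, (1 <= k)%N ->
     [/\ v k = (fun i => 2 *: B i (y k i) - B i (y k.-1 i)),
         z k.+1 = (fun i => z k i - x k i +
             mxact Wt (fun j => 2 *: x k j - x k.-1 j
                                - mxact Lam (fun l => v k l - v k.-1 l) j) i),
         x k.+1 = J (z k.+1)
       & y k.+1 = (fun i => x k i + z k.+1 i - z k i)]) ->
  exists zs : 'I_N -> H,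
    [/\ weak_cvgN ip z zs,
        weak_cvgN ip x (J zs),
        weak_cvgN ip y (J zs)
      & exists xs : H, J zs = (fun _ => xs) /\ is_zero_of_sum A B xs].
Proof.
move=> hip N0 mA L0 mB lB [x0 [u [Au u0]]] _ [_ sW kW _ pW] ha Lam Lamh b0 hb Wt J.
move=> v0 x0E y1 z1 x1 hk.
have a0 i : 0 < alpha i by case: (ha i).
have a_neq0 i : alpha i != 0 by rewrite gt_eqF.
pose D : 'M[R]_N := (beta / 2) *: (1%:M - W).
have b2 : 0 < beta / 2 by rewrite divr_gt0.
have sD : D^T = D by rewrite /D linearZ /= linearB /= trmx1 sW.
have pD : mx_psd D.
  move=> g; rewrite /D -scalemxAr -scalemxAl mxE mulr_ge0 ?(ltW b2)//; exact: pW.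
have kD (g : 'cV[R]_N) : D *m g = 0 <-> exists c : R, g = c *: const_mx 1.
  rewrite -kW /D -scalemxAl; split=> [/eqP|->]; last by rewrite scaler0.
  by rewrite scaler_eq0 gt_eqF//= => /eqP.
have pG : mx_psd (D - D *m Lam *m D).
  apply: stepsize_psd => // g.
  have -> : diag_mx (\row_i Num.sqrt (alpha i)) *m D *m diag_mx (\row_i Num.sqrt (alpha i))
      = beta *: (Lamh *m (2^-1 *: (1%:M - W)) *m Lamh).
    by rewrite /D -scalerA -scalemxAr -scalemxAl.
  rewrite -scalemxAl vnormZ gtr0_norm//.
  apply: le_trans (_ : beta * (mx_opnorm (Lamh *m (2^-1 *: (1%:M - W)) *m Lamh) * vnorm g) <= _).
    by rewrite ler_pM2l// vnorm_mulmx.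
  by rewrite mulrA -[X in _ <= X]mul1r ler_wpM2r ?vnorm_ge0// ltW.
have [Q [sQ pQ sumD dualQ]] := dual_metric hip N0 sD kD pG.
(* Finitely many strict step size bounds leave a common margin [1 - c]. *)
have [c [c0 c1 hc]] : exists c, [/\ 0 <= c, c < 1 & forall i, 8 * (alpha i * L i) <= c].
  apply: uniform_ratio => i; have [_] := ha i.
  by rewrite -[X in _ < X]mul1r ltr_pdivlMr ?mulr_gt0// mulrCA.
have Lc i : alpha i * L i <= c / 8 by rewrite ler_pdivlMr// mulrC.
have xE k i : x k i = resolvent (alpha i) (A i) (z k i).
  case: k => [|[|k]]; [by rewrite x0E|by rewrite x1|].
  by have [_ _ -> _] := hk k.+1 isT.
pose w k i := (alpha i)^-1 *: (x k i - z k.+1 i) - v k i.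
have zE k i : z k.+1 i = x k i - alpha i *: (v k i + w k i).
  by apply: (ip_ext hip) => h; rewrite /w !(ipE hip); field.
have yE k i : y k.+1 i = x k i + z k.+1 i - z k i.
  case: k => [|k]; last by have [_ _ _ ->] := hk k.+1 isT.
  by rewrite z1; apply: (ip_ext hip) => h; rewrite !(ipE hip); ring.
have vE k i : v k.+1 i = 2 *: B i (y k.+1 i) - B i (y k i).
  by have [-> _ _ _] := hk k.+1 isT.
(* The special first step amounts to [w^0 = 0], which starts the induction for zero sums. *)
have w0 i : w 0%N i = 0.
  rewrite /w z1 y1 mxact_diag; apply: (ip_ext hip) => h.
  by rewrite (ip0l hip) !(ipE hip); field.
have dwE k : (fun i => w k.+1 i - w k i) =
    mxact D (fun j => y k.+2 j + alpha j *: (w k.+1 j - w k j)).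
  have [_ z2 _ _] := hk k.+1 isT.
  (* [t] is the argument of [Wt] in the scheme. In [y^{k+2} + Lam (w^{k+1} - w^k)] the unknown
     [z^{k+2}] cancels and leaves the same vector, so [Wt = I - Lam D] makes the increment of [w]
     equal to [D t]. *)
  pose t j := 2 *: x k.+1 j - x k j - alpha j *: (v k.+1 j - v k j).
  have -> : (fun j => y k.+2 j + alpha j *: (w k.+1 j - w k j)) = t.
    apply/funext => j; rewrite /w /t yE; apply: (ip_ext hip) => h.
    by rewrite !(ipE hip); field.
  have {}z2 i : z k.+2 i = z k.+1 i - x k.+1 i + (t i - alpha i *: mxact D t i).
    rewrite z2; congr (_ + _).
    have -> : (fun j => 2 *: x k.+1 j - x k.+1.-1 j
        - mxact Lam (fun l => v k.+1 l - v k.+1.-1 l) j) = t.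
      by apply/funext => j; rewrite mxact_diag.
    have -> : Wt = 1%:M - Lam *m D by rewrite /Wt /D scalemxAr.
    by rewrite mxactB mxact1 mxactM mxact_diag.
  apply/funext => i; rewrite /w z2 /t; move: (mxact D _ i) => Dt.
  by apply: (ip_ext hip) => h; rewrite !(ipE hip); field.
have sw k : \sum_i w k i = 0.
  elim: k => [|k ih]; first by rewrite big1.
  by have := sumD (fun j => y k.+2 j + alpha j *: (w k.+1 j - w k j)); rewrite -dwE sumrB ih subr0.
have dual k (h : 'I_N -> H) : \sum_i h i = 0 ->
    prod_ip ip h (y k.+2) = prod_ip ip h (mxact Q (fun i => w k.+1 i - w k i)).
  by move=> h0; apply: dualQ => //; exact: dwE.
have hs0 : is_saddle A B alpha x0 (fun i => x0 + alpha i *: u i) (fun i => - (u i + B i x0)).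
  split=> [i|i|].
  - by rewrite addrAC subrr add0r scalerA mulVf// scale1r.
  - by apply: (ip_ext hip) => h; rewrite !(ipE hip); ring.
  - by rewrite sumrN u0 oppr0.
have [xs [zs [ws [hs hc']]]] := iteration_weak_cvg hip mA mB lB L0 a0 c0 c1 Lc
  xE zE yE vE sQ pQ sw dual hs0 N0.
have JE : J zs = fun=> xs.
  by apply/funext => i; exact: (saddle_resolvent hip mA a0 i hs).
exists zs; rewrite JE; split.
- by move=> g; apply: cvg_sum_ord => i; have [] := hc' i (g i).
- by move=> g; apply: cvg_sum_ord => i; have [] := hc' i (g i).
- by move=> g; apply: cvg_sum_ord => i; have [] := hc' i (g i).
exists xs; split => //; have [Axs zsE ws0] := hs.
exists (fun i => (alpha i)^-1 *: (zs i - xs)); split => //.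
transitivity (\sum_i - ws i); last by rewrite sumrN ws0 oppr0.
apply: eq_bigr => i _.
by apply: (ip_ext hip) => h; rewrite {1}zsE !(ipE hip); field.
Qed.
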